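(* Assume that $\Lambda=K\Gamma/I$ satisfies condition (N). Let $p=\beta_l\cdots\beta_1\in K\Gamma$ be a mast of positive length $l$, consisting of arrows $\beta_i:e(i-1)\to e(i)$, such that the set of isomorphism types of uniserial left $\Lambda$-modules with mast $p$ is finite. Then, given any slack halyard $(\alpha,u)=(\alpha,\beta_\mu\cdots\beta_1)$ on $p$, with a slack variable $X_r(\alpha,u)$ say, the following is true: There exists a right subpath $w:e(0)\to e(0)$ of $p$ of positive length such that $v_r(\alpha,u)$ is of the form $$v_r(\alpha,u)=\alpha\,\epsilon_\mu\beta_\mu\,\epsilon_{\mu-1}\cdots\epsilon_2\beta_2\,\epsilon_1\beta_1\,w$$ in $K\Gamma$, where each $\epsilon_i$ is an oriented cycle $e(i)\to e(i)$ which may be trivial (i.e. $\epsilon_i=e(i)$ is allowed). Moreover, if $\dim V_p=d$, the path $p$ passes at least $d+1$ times through the vertex $e(0)$, including the start.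
   Context: **Setting.** $K$ is an infinite field, $\Gamma$ a finite quiver, $I$ an admissible ideal of the path algebra $K\Gamma$, $\Lambda=K\Gamma/I$ (a finite dimensional split basic $K$-algebra), and $J$ its Jacobson radical. Vertices of $\Gamma$ are identified with the corresponding primitive idempotents of $\Lambda$. Paths are composed so that $qp$ means ''$q$ after $p$''; vertices are the paths of length $0$. A right subpath of a path $p$ is a path $u$ with $p=u'u$ in $K\Gamma$ for some path $u'$ (lengths $0$ allowed). Modules are finitely generated left modules. **Uniserial modules, masts.** A module is uniserial if its submodules form a chain. If $U$ is uniserial of composition length $l+1$, a mast of $U$ is a path $p$ in $K\Gamma$ of length $l$ with $pU\neq 0$; a path is called a mast if it is a mast of some uniserial left $\Lambda$-module. A top element of $U$ is an element $x\in U\setminus JU$ with $x=ex$ for a vertex $e$. **Condition (N).** Whenever $\alpha:e\to e'$ is an arrow in $\Gamma$ and $p:e\to e'$ is a mast of positive length, then $p\in K\Gamma\alpha\cup\alpha K\Gamma$ (i.e. $p$ starts or ends with the arrow $\alpha$). **Detours and $V_p$.** Let $p$ be a path. A detour on $p$ is a pair $(\alpha,u)$ with $u$ a right subpath of $p$ (possibly of length $0$) and $\alpha$ an arrow such that $\alpha u$ is a path which is not a right subpath of $p$, but there is a right subpath of $p$ strictly longer than $u$ ending in the same vertex as $\alpha$. All right subpaths of $p$ that are longer than $u$ and end in the same vertex as $\alpha$ are denoted $v_i(\alpha,u)$, $i\in I(\alpha,u)$. Let $D$ be the set of triples $(\alpha,u,i)$ with $(\alpha,u)$ a detour on $p$ and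 $i\in I(\alpha,u)$, with corresponding independent variables $X_i(\alpha,u)$. $V_p\subseteq K^D$ is the set of all points $k=(k_i(\alpha,u))$ for which there are a uniserial left $\Lambda$-module $U$ with mast $p$ and a top element $x$ of $U$ with $\alpha ux=\sum_{i\in I(\alpha,u)}k_i(\alpha,u)v_i(\alpha,u)x$ for all detours $(\alpha,u)$ on $p$; this set is known to be Zariski closed. $A_p$ is the coordinate ring of $V_p$, i.e. the polynomial ring in the $X_i(\alpha,u)$ modulo the ideal of polynomials vanishing on $V_p$; $\dim V_p$ is the (Krull) dimension of $V_p$. **Halyards.** Let $p$ be a mast. A detour $(\alpha,u)$ on $p$ is a halyard on $p$ if some $X_j(\alpha,u)$ has nonzero image in $A_p$ (equivalently, $\alpha ux\neq0$ for some uniserial module with mast $p$ and some top element $x$ of it). A variable $X_j(\alpha,u)$ of a halyard $(\alpha,u)$ is slack if its image in $A_p$ is transcendental over $K$ (equivalently, the coordinate $k_j(\alpha,u)$ takes infinitely many values on $V_p$). A halyard is slack if it has at least one slack variable. *)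

(* Defs.v *)
From HB Require Import structures.
From mathcomp Require Import all_boot all_order all_algebra.
From mathcomp Require Import generic_quotient ring_quotient finmap.
From mathcomp Require Import boolp classical_sets cardinality.
From mathcomp Require Import monalg.

Set Implicit Arguments.
Unset Strict Implicit.
Unset Printing Implicit Defensive.

Import GRing.Theory.
Local Open Scope classical_set_scope.
Local Open Scope ring_scope.

(* Rings are [pzRingType]s (possibly trivial), because quotients by arbitrary
   ideals are formed. *)

Record ideal (R : pzRingType) := Ideal {
  ideal_set :> set R;
  ideal0 : ideal_set 0;
  idealB : forall x y, ideal_set x -> ideal_set y -> ideal_set (x - y);
  idealMl : forall a x, ideal_set x -> ideal_set (a * x);
  idealMr : forall a x, ideal_set x -> ideal_set (x * a)
}.

Section IdealQuotient.
Variables (R : pzRingType) (I : ideal R).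

Definition ideal_pred : {pred R} := fun x => `[< ideal_set I x >].

Lemma ideal_predP x : reflect (ideal_set I x) (x \in ideal_pred).
Proof. exact: asboolP. Qed.

Fact ideal_pred_zmod_closed : zmod_closed ideal_pred.
Proof.
split=> [|x y /ideal_predP Ix /ideal_predP Iy]; apply/ideal_predP.
  exact: ideal0.
exact: idealB.
Qed.
HB.instance Definition _ :=
  GRing.isZmodClosed.Build R ideal_pred ideal_pred_zmod_closed.

Definition ring_quot : Type := Quotient.quot ideal_pred.
HB.instance Definition _ := GRing.Zmodule.on ring_quot.

Definition quot_proj (x : R) : ring_quot := \pi_(Quotient.quot ideal_pred)%qT x.

Lemma quot_projP x y : quot_proj x = quot_proj y <-> ideal_set I (x - y).
Proof.
split=> [/eqP|/ideal_predP]; last by rewrite Quotient.idealrBE => /eqP.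
by rewrite -Quotient.idealrBE => /ideal_predP.
Qed.

Lemma quot_proj_surj (q : ring_quot) : exists x, quot_proj x = q.
Proof. by exists (repr (q : Quotient.quot ideal_pred)); exact: reprK. Qed.

Fact quot_projD : {morph quot_proj : x y / x + y}.
Proof. by move=> x y; rewrite /quot_proj !piE. Qed.

Fact quot_proj0 : quot_proj 0 = 0.
Proof. by rewrite /quot_proj !piE. Qed.

Fact quot_projB : {morph quot_proj : x y / x - y}.
Proof. by move=> x y; rewrite /quot_proj !piE. Qed.

Definition quot_one : ring_quot := quot_proj 1.
Definition quot_mul (a b : ring_quot) : ring_quot :=
  quot_proj (repr (a : Quotient.quot ideal_pred) *
             repr (b : Quotient.quot ideal_pred)).

Fact quot_mul_proj x y : quot_mul (quot_proj x) (quot_proj y) = quot_proj (x * y).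
Proof.
rewrite /quot_mul; set x' := repr _; set y' := repr _; apply/quot_projP.
have Ix : ideal_set I (x' - x) by apply/quot_projP; exact: reprK.
have Iy : ideal_set I (y' - y) by apply/quot_projP; exact: reprK.
have IN z : ideal_set I z -> ideal_set I (- z).
  by move=> Iz; rewrite -sub0r; apply: idealB => //; exact: ideal0.
have -> : x' * y' - x * y = x' * (y' - y) - (- ((x' - x) * y)).
  by rewrite opprK mulrBr mulrBl addrA subrK.
by apply: idealB; [exact: idealMl|apply: IN; exact: idealMr].
Qed.

Fact quot_mulA : associative quot_mul.
Proof.
move=> a b c; have [x <-] := quot_proj_surj a; have [y <-] := quot_proj_surj b.
by have [z <-] := quot_proj_surj c; rewrite !quot_mul_proj mulrA.
Qed.

Fact quot_mul1 : left_id quot_one quot_mul.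
Proof.
by move=> a; have [x <-] := quot_proj_surj a; rewrite quot_mul_proj mul1r.
Qed.

Fact quot_mulr1 : right_id quot_one quot_mul.
Proof.
by move=> a; have [x <-] := quot_proj_surj a; rewrite quot_mul_proj mulr1.
Qed.

Fact quot_mulDl : left_distributive quot_mul +%R.
Proof.
move=> a b c; have [x <-] := quot_proj_surj a; have [y <-] := quot_proj_surj b.
have [z <-] := quot_proj_surj c.
by rewrite -quot_projD !quot_mul_proj -quot_projD mulrDl.
Qed.

Fact quot_mulDr : right_distributive quot_mul +%R.
Proof.
move=> a b c; have [x <-] := quot_proj_surj a; have [y <-] := quot_proj_surj b.
have [z <-] := quot_proj_surj c.
by rewrite -quot_projD !quot_mul_proj -quot_projD mulrDr.
Qed.

HB.instance Definition _ := GRing.Zmodule_isPzRing.Build ring_quot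
  quot_mulA quot_mul1 quot_mulr1 quot_mulDl quot_mulDr.

Fact quot_proj_zmod_morphism : zmod_morphism quot_proj.
Proof. exact: quot_projB. Qed.
HB.instance Definition _ :=
  GRing.isZmodMorphism.Build R ring_quot quot_proj quot_proj_zmod_morphism.

Fact quot_proj_monoid_morphism : monoid_morphism quot_proj.
Proof. by split=> // x y; rewrite -quot_mul_proj. Qed.
HB.instance Definition _ :=
  GRing.isMonoidMorphism.Build R ring_quot quot_proj quot_proj_monoid_morphism.

End IdealQuotient.

Section ComIdealQuotient.
Variables (R : comPzRingType) (I : ideal R).

Fact quot_mulC : commutative (@GRing.mul (ring_quot I)).
Proof.
move=> a b; have [x <-] := quot_proj_surj a; have [y <-] := quot_proj_surj b.
by rewrite -!rmorphM mulrC.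
Qed.
HB.instance Definition _ :=
  GRing.PzRing_hasCommutativeMul.Build (ring_quot I) quot_mulC.

End ComIdealQuotient.

Section Modules.
Variable R : pzRingType.

Definition submodule (U : lmodType R) (N : set U) : Prop :=
  N 0 /\ forall (a : R) (x y : U), N x -> N y -> N (a *: x + y).

Definition finitely_generated (U : lmodType R) : Prop :=
  exists s : seq U, forall N : set U,
    submodule N -> (forall x, x \in s -> N x) -> N = setT.

Definition uniserial (U : lmodType R) : Prop :=
  finitely_generated U /\
  forall N N' : set U, submodule N -> submodule N' -> N `<=` N' \/ N' `<=` N.

(* For submodules N, N', this says that N' / N is a simple module. *)
Definition maximal_in (U : lmodType R) (N N' : set U) : Prop :=
  N `<` N' /\
  forall L : set U, submodule L -> N `<=` L -> L `<=` N' -> L = N \/ L = N'.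

Definition composition_length (U : lmodType R) (n : nat) : Prop :=
  exists M : nat -> set U,
    [/\ M 0%N = [set 0], M n = setT,
        forall i, (i <= n)%N -> submodule (M i)
      & forall i, (i < n)%N -> maximal_in (M i) (M i.+1)].

Definition jacobson_radical : set R :=
  [set a | forall M : set R^o, submodule M -> maximal_in M setT -> M a].

Definition radical_submodule (U : lmodType R) : set U :=
  [set y | exists s : seq (R * U),
     (forall t, t \in s -> jacobson_radical t.1) /\
     y = \sum_(t <- s) t.1 *: t.2].

Definition isomorphic (U W : lmodType R) : Prop :=
  exists f : {linear U -> W}, bijective f.

End Modules.

Section KrullDimension.
Variable R : comPzRingType.

Definition prime_ideal (P : set R) : Prop :=
  [/\ @submodule R R^o P, ~ P 1 & forall a b, P (a * b) -> P a \/ P b].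

Definition prime_chain (n : nat) (P : nat -> set R) : Prop :=
  (forall i, (i <= n)%N -> prime_ideal (P i)) /\
  (forall i, (i < n)%N -> P i `<` P i.+1).

Definition has_krull_dim (d : nat) : Prop :=
  (exists P, prime_chain d P) /\
  forall n P, prime_chain n P -> (n <= d)%N.

End KrullDimension.

Definition transcendental (K : fieldType) (A : pzRingType) (iota : K -> A)
    (a : A) : Prop :=
  forall q : {poly K}, \sum_(i < size q) iota q`_i * a ^+ i = 0 -> q = 0.

Record quiver := Quiver {
  vertex : finType;
  arrow : finType;
  src : arrow -> vertex;
  tgt : arrow -> vertex
}.

Section Paths.
Variable G : quiver.

Fixpoint is_path (e : vertex G) (s : seq (arrow G)) : bool :=
  if s is a :: s' then (src a == e) && is_path (tgt a) s' else true.

(* The path [beta_l ... beta_1] starting in [e] is encoded by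
   [(e, [:: beta_1; ...; beta_l])]: arrows are listed in order of traversal. *)
Record qpath := QPath {
  qpath_val : vertex G * seq (arrow G);
  _ : is_path qpath_val.1 qpath_val.2
}.
HB.instance Definition _ := [isSub for qpath_val].
HB.instance Definition _ := [Choice of qpath by <:].

Definition pstart (p : qpath) : vertex G := (val p).1.
Definition parrows (p : qpath) : seq (arrow G) := (val p).2.
Definition plen (p : qpath) : nat := size (parrows p).

Definition pverts (p : qpath) : seq (vertex G) :=
  pstart p :: map (@tgt G) (parrows p).
Definition pend (p : qpath) : vertex G :=
  last (pstart p) (map (@tgt G) (parrows p)).

Definition vertex_path (e : vertex G) : qpath :=
  @QPath (e, [::]) isT.

Fact is_path_arrow (a : arrow G) : is_path (src a) [:: a].
Proof. by rewrite /= eqxx. Qed.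
Definition arrow_path (a : arrow G) : qpath :=
  @QPath (src a, [:: a]) (is_path_arrow a).

(* [pcomp q p] is the path "q after p". *)
Definition pcomp (q p : qpath) : option qpath :=
  if pend p == pstart q then insub (pstart p, parrows p ++ parrows q) else None.

Definition right_subpaths (p : qpath) : seq qpath :=
  pmap insub [seq (pstart p, take i (parrows p)) | i <- iota 0 (plen p).+1].

Fact is_path_cat e s t :
  is_path e (s ++ t) = is_path e s && is_path (last e (map (@tgt G) s)) t.
Proof. by elim: s e => //= a s IHs e; rewrite IHs andbA. Qed.

Lemma pcompP q p r :
  pcomp q p = Some r <->
  [/\ pend p = pstart q, pstart r = pstart p
    & parrows r = parrows p ++ parrows q].
Proof.
rewrite /pcomp; case: eqP => [epq|npq]; last by split=> // -[].
case: insubP => [s _ Es|].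
  have Ps : pstart s = pstart p /\ parrows s = parrows p ++ parrows q.
    by rewrite /pstart /parrows Es.
  split=> [[<-]|[_ r1 r2]]; first by case: Ps.
  congr Some; apply: val_inj; rewrite /= [LHS]surjective_pairing.
  rewrite [RHS]surjective_pairing; case: Ps; rewrite /pstart /parrows /=.
  by move: r1 r2; rewrite /pstart /parrows /= => -> -> -> ->.
rewrite /= is_path_cat (valP p) /= -/(pend p) epq => /negP[].
exact: (valP q).
Qed.

Lemma right_subpathP u p :
  reflect (exists u', pcomp u' u = Some p) (u \in right_subpaths p).
Proof.
rewrite mem_pmap_sub; apply: (iffP mapP) => [[i _ Eu]|[u' /pcompP[eu s a]]].
  have [ps pt]: is_path (pstart p) (take i (parrows p)) /\
      is_path (last (pstart p) (map (@tgt G) (take i (parrows p))))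
        (drop i (parrows p)).
    by apply/andP; rewrite -is_path_cat cat_take_drop; exact: (valP p).
  exists (@QPath (_, _) pt); apply/pcompP.
  by rewrite /pend /pstart /parrows /= Eu /= cat_take_drop.
exists (plen u); last first.
  by rewrite a take_size_cat // s [LHS]surjective_pairing.
by rewrite mem_iota /= add0n ltnS /plen a size_cat leq_addr.
Qed.

Lemma pcompA r q p :
  obind (pcomp r) (pcomp q p) = obind (fun s => pcomp s p) (pcomp r q).
Proof.
have pendE s t u : pcomp s t = Some u -> pend u = pend s.
  case/pcompP; rewrite /pend => E1 -> ->.
  by rewrite map_cat last_cat E1.
have pcompT s t : pend t = pstart s -> exists u, pcomp s t = Some u.
  move=> E; rewrite /pcomp E eqxx; case: insubP => [u _ _|]; first by exists u.
  rewrite /= is_path_cat (valP t) /= -/(pend t) E => /negP[].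
  exact: (valP s).
have pcompN s t : pend t <> pstart s -> pcomp s t = None.
  by rewrite /pcomp => /eqP/negPf->.
case Eqp: (pcomp q p) => [s|] /=; case Erq: (pcomp r q) => [t|] //=.
- have [e1 s1 a1] := (pcompP _ _ _).1 Eqp; have [e2 s2 a2] := (pcompP _ _ _).1 Erq.
  have [v Ev] := pcompT r s (etrans (pendE _ _ _ Eqp) e2).
  rewrite Ev; apply/esym/pcompP; have [_ s3 a3] := (pcompP _ _ _).1 Ev.
  by split; [rewrite s2|rewrite s3|rewrite a3 a1 a2 catA].
- apply: pcompN; rewrite (pendE _ _ _ Eqp) => E.
  by have [v] := pcompT _ _ E; rewrite Erq.
- apply/esym/pcompN; have [_ s2 _] := (pcompP _ _ _).1 Erq; rewrite s2 => E.
  by have [v] := pcompT _ _ E; rewrite Eqp.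
Qed.

End Paths.

Definition path_algebra (K : fieldType) (G : quiver) : Type := {malg K[qpath G]}.
HB.instance Definition _ K G := GRing.Lmodule.on (path_algebra K G).

(* Locked only to keep unification from unfolding finitely supported functions;
   the same goes for [path_mul]. *)
HB.lock Definition path_elt (K : fieldType) (G : quiver) (p : qpath G) :
  path_algebra K G := mkmalgU p 1.

Definition path_mul2 (K : fieldType) (G : quiver) (q p : qpath G) :
  path_algebra K G := oapp (@path_elt K G) 0 (pcomp q p).

HB.lock Definition path_mul (K : fieldType) (G : quiver) (f g : path_algebra K G) :
    path_algebra K G :=
  \sum_(q <- msupp f) \sum_(p <- msupp g) (f@_q * g@_p) *: path_mul2 K q p.

Section PathAlgebra.
Variables (K : fieldType) (G : quiver).
Local Notation path_algebra := (path_algebra K G).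
Local Notation path_elt := (@path_elt K G).
Local Notation path_mul2 := (@path_mul2 K G).
Local Notation path_mul := (@path_mul K G).

Definition path_one : path_algebra :=
  \sum_(e : vertex G) path_elt (vertex_path e).

(* Linear extension of a function given on paths. *)
Let ext (h : qpath G -> path_algebra) (f : path_algebra) : path_algebra :=
  \sum_(q <- msupp f) f@_q *: h q.

Let extEw h (f : path_algebra) (D : {fset qpath G}) : (msupp f `<=` D)%fset ->
  ext h f = \sum_(q <- D) f@_q *: h q.
Proof.
move=> le; rewrite /ext; apply: big_fset_incl => // q _.
by move/mcoeff_outdom->; rewrite scale0r.
Qed.

Let ext_linear h a f g : ext h (a *: f + g) = a *: ext h f + ext h g.
Proof.
pose D := (msupp (a *: f + g) `|` (msupp f `|` msupp g))%fset.
rewrite (@extEw _ _ D) ?fsubsetUl // (@extEw _ f D); last first.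
  by rewrite /D fsetUC -fsetUA fsubsetUl.
rewrite (@extEw _ g D); last by rewrite /D fsetUA fsubsetUr.
rewrite scaler_sumr -big_split /=; apply: eq_bigr => q _.
by rewrite mcoeffD mcoeffZ scalerDl scalerA.
Qed.

Let ext0 h : ext h 0 = 0.
Proof. by rewrite /ext msupp0 big_seq_fset0. Qed.
Let extD h f g : ext h (f + g) = ext h f + ext h g.
Proof. by have := ext_linear h 1 f g; rewrite !scale1r. Qed.
Let extZ h a f : ext h (a *: f) = a *: ext h f.
Proof.
have := ext_linear h a f 0.
by rewrite ext0 [X in ext h X]addr0 [X in _ = X -> _]addr0.
Qed.
Let ext_sum h (T : Type) (r : seq T) F :
  ext h (\sum_(i <- r) F i) = \sum_(i <- r) ext h (F i).
Proof. by apply: big_morph; [exact: extD|exact: ext0]. Qed.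

Let ext_elt h q : ext h (path_elt q) = h q.
Proof.
by rewrite /ext path_elt.unlock msuppU oner_eq0 big_seq_fset1 mcoeffUU scale1r.
Qed.

Lemma path_algebraE (f : path_algebra) : f = \sum_(q <- msupp f) f@_q *: path_elt q.
Proof.
rewrite [LHS]monalgE; apply: eq_bigr => q _; apply/malgP => k.
rewrite path_elt.unlock (mcoeffZ f@_q (mkmalgU q 1) k) [LHS](mcoeffU q f@_q k).
by rewrite [X in _ * X](mcoeffU q 1 k) mulrnAr mulr1.
Qed.

Lemma path_algebra_ind (P : path_algebra -> Prop) :
  P 0 -> (forall a f g, P f -> P g -> P (a *: f + g)) ->
  (forall p, P (path_elt p)) -> forall f, P f.
Proof.
move=> P0 PD Pp f; rewrite [f]path_algebraE.
by apply: big_rec => // q g _; apply: PD.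
Qed.

Let mulE f g : path_mul f g = ext (fun q => ext (path_mul2 q) g) f.
Proof.
rewrite path_mul.unlock /ext; apply: eq_bigr => q _; rewrite scaler_sumr; apply: eq_bigr => p _.
by rewrite scalerA.
Qed.

Let eq_ext h h' f : h =1 h' -> ext h f = ext h' f.
Proof. by move=> E; rewrite /ext; apply: eq_bigr => q _; rewrite E. Qed.

Let mulDl : left_distributive path_mul +%R.
Proof. by move=> f g h; rewrite !mulE extD. Qed.
Let mulDr : right_distributive path_mul +%R.
Proof.
move=> f g h; rewrite !mulE /ext -big_split /=; apply: eq_bigr => q _.
by rewrite -/(ext _ _) extD scalerDr.
Qed.
Let mul0l f : path_mul 0 f = 0. Proof. by rewrite mulE ext0. Qed.
Let mul0r f : path_mul f 0 = 0.
Proof. by rewrite mulE /ext big1 // => q _; rewrite msupp0 big_seq_fset0 scaler0. Qed.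
Let mulZl a f g : path_mul (a *: f) g = a *: path_mul f g.
Proof. by rewrite !mulE extZ. Qed.
Let mulZr a f g : path_mul f (a *: g) = a *: path_mul f g.
Proof.
rewrite !mulE [in RHS]/ext scaler_sumr; apply: eq_bigr => q _.
by rewrite extZ !scalerA mulrC.
Qed.
Let mul_suml (T : Type) (r : seq T) F g :
  path_mul (\sum_(i <- r) F i) g = \sum_(i <- r) path_mul (F i) g.
Proof.
by apply: (big_morph (path_mul^~ g)) => [x y|]; [exact: mulDl|exact: mul0l].
Qed.
Let mul_sumr (T : Type) (r : seq T) F f :
  path_mul f (\sum_(i <- r) F i) = \sum_(i <- r) path_mul f (F i).
Proof.
by apply: (big_morph (path_mul f)) => [x y|]; [exact: mulDr|exact: mul0r].
Qed.

Let mul_elt q p : path_mul (path_elt q) (path_elt p) = path_mul2 q p.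
Proof. by rewrite mulE !ext_elt. Qed.

Fact path_mulA : associative path_mul.
Proof.
have A0 r q p : path_mul (path_elt r) (path_mul (path_elt q) (path_elt p)) =
    path_mul (path_mul (path_elt r) (path_elt q)) (path_elt p).
  rewrite (mul_elt q p) (mul_elt r q) /path_mul2; have := pcompA r q p.
  case: (pcomp q p) => [s|]; case: (pcomp r q) => [t|] E;
    rewrite [obind _ _]/= [obind _ _ in RHS]/= in E.
  - by apply: etrans (mul_elt r s) _; rewrite /path_mul2 E; exact/esym/mul_elt.
  - by apply: etrans (mul_elt r s) _; rewrite /path_mul2 E; exact/esym/mul0l.
  - by apply: etrans (mul0r _) _; apply/esym/(etrans (mul_elt t p)); rewrite /path_mul2 -E.
  - by apply: etrans (mul0r _) _; exact/esym/mul0l.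
have A1 r q h : path_mul (path_elt r) (path_mul (path_elt q) h) =
    path_mul (path_mul (path_elt r) (path_elt q)) h.
  elim/path_algebra_ind: h => [|a f g IHf IHg|p]; last exact: A0.
    by rewrite (mul0r (path_elt q)) (mul0r (path_elt r)) mul0r.
  by rewrite !(mulDr, mulZr) IHf IHg.
have A2 r g h : path_mul (path_elt r) (path_mul g h) =
    path_mul (path_mul (path_elt r) g) h.
  elim/path_algebra_ind: g => [|a f g IHf IHg|q]; last exact: A1.
    by rewrite (mul0l h) (mul0r (path_elt r)) (mul0l h).
  by rewrite !(mulDr, mulDl, mulZr, mulZl) IHf IHg.
move=> f g h; elim/path_algebra_ind: f => [|a f f' IHf IHf'|r]; last exact: A2.
  by rewrite (mul0l g) (mul0l h) (mul0l (path_mul g h)).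
by rewrite !(mulDl, mulZl) IHf IHf'.
Qed.

Fact path_mul1 : left_id path_one path_mul.
Proof.
move=> f; elim/path_algebra_ind: f => [|a f g IHf IHg|p]; first exact: mul0r.
  by rewrite mulDr mulZr IHf IHg.
rewrite /path_one mul_suml (bigD1 (pend p)) //= big1 => [|e ne].
  rewrite addr0 mul_elt /path_mul2 (_ : pcomp _ _ = Some p) //.
  by apply/pcompP; rewrite cats0.
by rewrite mul_elt /path_mul2 /pcomp eq_sym (negPf ne).
Qed.

Fact path_mulr1 : right_id path_one path_mul.
Proof.
move=> f; elim/path_algebra_ind: f => [|a f g IHf IHg|p]; first exact: mul0l.
  by rewrite mulDl mulZl IHf IHg.
rewrite /path_one mul_sumr (bigD1 (pstart p)) //= big1 => [|e ne].
  rewrite addr0 mul_elt /path_mul2 (_ : pcomp _ _ = Some p) //.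
  by apply/pcompP.
by rewrite mul_elt /path_mul2 /pcomp (negPf ne).
Qed.

HB.instance Definition _ := GRing.Zmodule_isPzRing.Build path_algebra
  path_mulA path_mul1 path_mulr1 mulDl mulDr.

Lemma path_eltM q p : path_elt q * path_elt p = oapp path_elt 0 (pcomp q p).
Proof. exact: mul_elt. Qed.
Lemma path_scalerAl a (f g : path_algebra) : a *: (f * g) = (a *: f) * g.
Proof. by rewrite [RHS]mulZl. Qed.
Lemma path_scalerAr a (f g : path_algebra) : a *: (f * g) = f * (a *: g).
Proof. by rewrite [RHS]mulZr. Qed.

(* The n-th power of the ideal generated by the arrows is spanned by the paths
   of length at least n. *)
Definition arrow_ideal_power (n : nat) : set path_algebra :=
  [set f | forall p, p \in msupp f -> (n <= plen p)%N].

Definition admissible (I : ideal path_algebra) : Prop :=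
  I `<=` arrow_ideal_power 2 /\
  exists2 n, (2 <= n)%N & arrow_ideal_power n `<=` I.

End PathAlgebra.

Section Detours.
Variables (G : quiver) (p : qpath G).

(* The right subpaths [v_i(alpha, u)]; the index [i] is the path itself. *)
Definition detour_targets (alpha : arrow G) (u : qpath G) : seq (qpath G) :=
  [seq v <- right_subpaths p | (plen u < plen v)%N & pend v == tgt alpha].

Definition detour (alpha : arrow G) (u : qpath G) : bool :=
  [&& u \in right_subpaths p,
      oapp (fun q => q \notin right_subpaths p) false (pcomp (arrow_path alpha) u)
    & detour_targets alpha u != [::]].

Definition detour_index : Type :=
  {t : arrow G * seq_sub (right_subpaths p) * seq_sub (right_subpaths p) |
     detour t.1.1 (ssval t.1.2) &&
     (ssval t.2 \in detour_targets t.1.1 (ssval t.1.2))}.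
HB.instance Definition _ := Finite.on detour_index.

Definition dx_arrow (t : detour_index) : arrow G := (val t).1.1.
Definition dx_sub (t : detour_index) : qpath G := ssval (val t).1.2.
Definition dx_target (t : detour_index) : qpath G := ssval (val t).2.

End Detours.

(* Imported here only: mpoly rebinds the notation [_@__] of monalg. *)
From mathcomp Require Import mpoly.

Section Uniserials.
Variables (K : fieldType) (G : quiver) (I : ideal (path_algebra K G)).

Definition quot_algebra : pzRingType := ring_quot I.

Definition quot_class (f : path_algebra K G) : quot_algebra := quot_proj I f.
Definition path_class (p : qpath G) : quot_algebra := quot_class (path_elt K p).

Definition uniserial_with_mast (p : qpath G) (U : lmodType quot_algebra) : Prop :=
  [/\ uniserial U, composition_length U (plen p).+1
    & exists x : U, path_class p *: x <> 0].

Definition is_mast (p : qpath G) : Prop :=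
  exists U : lmodType quot_algebra, uniserial_with_mast p U.

Definition top_element (U : lmodType quot_algebra) (x : U) : Prop :=
  ~ radical_submodule x /\
  exists e : vertex G, x = path_class (vertex_path e) *: x.

Definition condition_N : Prop :=
  forall (alpha : arrow G) (p : qpath G),
    pstart p = src alpha -> pend p = tgt alpha -> is_mast p -> (0 < plen p)%N ->
    exists c : path_algebra K G,
      path_elt K p = c * path_elt K (arrow_path alpha) \/
      path_elt K p = path_elt K (arrow_path alpha) * c.

Definition finitely_many_uniserials (p : qpath G) : Prop :=
  exists (n : nat) (M : 'I_n -> lmodType quot_algebra),
    forall U : lmodType quot_algebra,
      uniserial_with_mast p U -> exists i, isomorphic U (M i).

Section Variety.
Variable p : qpath G.

Definition mast_variety : set (detour_index p -> K) :=
  [set k | exists (U : lmodType quot_algebra) (x : U),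
     [/\ uniserial_with_mast p U, top_element x &
       forall alpha u, detour p alpha u ->
         quot_class (path_elt K (arrow_path alpha) * path_elt K u) *: x =
         \sum_(t : detour_index p | (dx_arrow t == alpha) && (dx_sub t == u))
            quot_class (k t *: path_elt K (dx_target t)) *: x]].

(* The variables X_i(alpha, u) are numbered through [enum_rank]. *)
Definition detour_polynomial : comPzRingType := mpoly #|{: detour_index p}| K.

Definition vanishing_set : set detour_polynomial :=
  [set f | forall k, mast_variety k -> f.@[fun i => k (enum_val i)] = 0].

Fact vanishing0 : vanishing_set 0.
Proof. by move=> k _; rewrite meval0. Qed.
Fact vanishingB f g : vanishing_set f -> vanishing_set g -> vanishing_set (f - g).
Proof. by move=> If Ig k Vk; rewrite mevalB If // Ig // subr0. Qed.
Fact vanishingMl a f : vanishing_set f -> vanishing_set (a * f).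
Proof. by move=> If k Vk; rewrite mevalM If // mulr0. Qed.
Fact vanishingMr a f : vanishing_set f -> vanishing_set (f * a).
Proof. by move=> If k Vk; rewrite mevalM If // mul0r. Qed.

Definition vanishing_ideal : ideal detour_polynomial :=
  Ideal vanishing0 vanishingB vanishingMl vanishingMr.

Definition coordinate_ring : comPzRingType := ring_quot vanishing_ideal.

Definition scalar_class (c : K) : coordinate_ring :=
  quot_proj vanishing_ideal (mpolyC _ c).
Definition variable_class (t : detour_index p) : coordinate_ring :=
  quot_proj vanishing_ideal 'X_(enum_rank t).

Definition dim_V (d : nat) : Prop := has_krull_dim coordinate_ring d.

Definition halyard (alpha : arrow G) (u : qpath G) : Prop :=
  detour p alpha u /\
  exists t : detour_index p,
    [/\ dx_arrow t = alpha, dx_sub t = u & variable_class t <> 0].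

Definition slack_variable (t : detour_index p) : Prop :=
  halyard (dx_arrow t) (dx_sub t) /\
  transcendental scalar_class (variable_class t).

Definition slack_halyard (alpha : arrow G) (u : qpath G) : Prop :=
  halyard alpha u /\
  exists t : detour_index p,
    [/\ dx_arrow t = alpha, dx_sub t = u & slack_variable t].

End Variety.
End Uniserials.

(* Main.v *)
Require Import Defs.
From HB Require Import structures.
From mathcomp Require Import all_boot all_order all_algebra.
From mathcomp Require Import generic_quotient ring_quotient.
From mathcomp Require Import boolp classical_sets cardinality.
From mathcomp Require Import mpoly.
From mathcomp Require monalg.

(** Let [x] be a top element of a uniserial module with mast [p] and let [b_j]
    be the image of [x] under the right subpath of [p] of length [j].  The [b_j]
    form a K-basis, and every arrow moves [b_j] into the span of later ones.
    Any segment of [p] from position [i] to position [j] is the mast of a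
    subquotient, so condition (N) says: [alpha b_i] is a combination of those
    [b_j], [j > i], for which the [j]-th arrow of [p] is [alpha].  Iterating, a
    path sends [b_i] into the span of the [b_j] such that its arrows can be read
    off [p], in order, after position [i], the last one just before position [j].

    A slack coordinate [k_r] takes infinitely many values, so it differs at two
    top elements [x] and [y] of a single module, and [y] is a combination of the
    [b_j].  Comparing coefficients at [v_r] in the two relations for
    [(alpha, u)], the coefficient can only change if [alpha u] can be read off
    [v_r] after some position [j > 0]; this is the required factorisation.

    For the dimension, normalise [y = b_0 + sum c_j b_j], with one parameter
    [c_j] for each return of [p] to its starting vertex.  The coordinates of the
    point of [V_p] given by [y] are polynomials in the [c_j], because the change
    of basis is unitriangular.  Hence [V_p] is covered by finitely many polynomial
    images of [K^m], where [m] is the number of returns, and [m + 1] functions on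
    it are algebraically dependent on each image.  A chain of [d + 1] primes, on
    the other hand, yields [d] functions independent modulo the smallest one. *)

Set Implicit Arguments.
Unset Strict Implicit.
Unset Printing Implicit Defensive.

Import GRing.Theory.
Local Open Scope classical_set_scope.
Local Open Scope ring_scope.

(* The name is also used by ssrfun, for composition of partial functions. *)
Local Notation pcomp := Defs.pcomp.

(** ** Submodules and quotient modules *)

Section SubQuotient.
Variables (R : pzRingType) (U : lmodType R) (N : set U) (HN : submodule N).

Definition submod_pred : {pred U} := fun x => `[< N x >].

Lemma submod_predP x : reflect (N x) (x \in submod_pred).
Proof. exact: asboolP. Qed.

Fact submod_pred_submod_closed : submod_closed submod_pred.
Proof.
case: HN => N0 NL; split=> [|a x y /submod_predP Nx /submod_predP Ny].
  exact/submod_predP.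
exact/submod_predP/NL.
Qed.
HB.instance Definition _ :=
  GRing.isSubmodClosed.Build R U submod_pred submod_pred_submod_closed.

Record submod_type := Submod { submod_val : U; _ : submod_val \in submod_pred }.
HB.instance Definition _ := [isSub for submod_val].
HB.instance Definition _ := [Choice of submod_type by <:].
HB.instance Definition _ := [SubChoice_isSubLmodule of submod_type by <:].

(** The ambient module enters later arguments only through an injection with image [N]; likewise a
    quotient only through a surjection with kernel [N]. *)
Lemma submodule_lmod : exists (S : lmodType R) (f : {linear S -> U}),
  injective f /\ forall z, N z <-> exists s, f s = z.
Proof.
exists submod_type, (val : {linear submod_type -> U}); split; first exact: val_inj.
move=> z; split=> [Nz|[s <-]]; last exact/submod_predP/(valP s).
by exists (Submod (introT (submod_predP z) Nz)).
Qed.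

Definition quotmod_type : Type := Quotient.quot submod_pred.
HB.instance Definition _ := GRing.Zmodule.on quotmod_type.

Definition quotmod_proj (x : U) : quotmod_type :=
  \pi_(Quotient.quot submod_pred)%qT x.

Lemma quotmod_projP x y : quotmod_proj x = quotmod_proj y <-> N (x - y).
Proof.
split=> [/eqP|/submod_predP]; last by rewrite Quotient.idealrBE => /eqP.
by rewrite -Quotient.idealrBE => /submod_predP.
Qed.

Lemma quotmod_proj_surj (q : quotmod_type) : exists x, quotmod_proj x = q.
Proof. by exists (repr (q : Quotient.quot submod_pred)); exact: reprK. Qed.

Fact quotmod_projD : {morph quotmod_proj : x y / x + y}.
Proof. by move=> x y; rewrite /quotmod_proj !piE. Qed.

Definition quotmod_scale (a : R) (q : quotmod_type) : quotmod_type :=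
  quotmod_proj (a *: repr (q : Quotient.quot submod_pred)).

Fact quotmod_scale_proj a x : quotmod_scale a (quotmod_proj x) = quotmod_proj (a *: x).
Proof.
apply/quotmod_projP; rewrite -scalerBr -[_ *: _]addr0.
by case: HN => N0; apply; [apply/quotmod_projP; exact: reprK|].
Qed.

Fact quotmod_scaleA a b v : quotmod_scale a (quotmod_scale b v) = quotmod_scale (a * b) v.
Proof.
by have [x <-] := quotmod_proj_surj v; rewrite !quotmod_scale_proj scalerA.
Qed.
Fact quotmod_scale1 : left_id 1 quotmod_scale.
Proof.
by move=> v; have [x <-] := quotmod_proj_surj v; rewrite quotmod_scale_proj scale1r.
Qed.
Fact quotmod_scaleDr : right_distributive quotmod_scale +%R.
Proof.
move=> a v w; have [x <-] := quotmod_proj_surj v; have [y <-] := quotmod_proj_surj w.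
by rewrite -quotmod_projD !quotmod_scale_proj -quotmod_projD scalerDr.
Qed.
Fact quotmod_scaleDl v : {morph quotmod_scale^~ v : a b / a + b}.
Proof.
move=> a b; have [x <-] := quotmod_proj_surj v.
by rewrite !quotmod_scale_proj -quotmod_projD scalerDl.
Qed.
HB.instance Definition _ := GRing.Zmodule_isLmodule.Build R quotmod_type
  quotmod_scaleA quotmod_scale1 quotmod_scaleDr quotmod_scaleDl.

Fact quotmod_proj_linear : linear quotmod_proj.
Proof. by move=> a x y; rewrite quotmod_projD -quotmod_scale_proj. Qed.
HB.instance Definition _ :=
  GRing.isLinear.Build R U quotmod_type *:%R quotmod_proj quotmod_proj_linear.

Lemma quotient_lmod : exists (Q : lmodType R) (f : {linear U -> Q}),
  (forall q, exists z, f z = q) /\ forall z, f z = 0 <-> N z.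
Proof.
exists quotmod_type, (quotmod_proj : {linear U -> quotmod_type}).
split; first exact: quotmod_proj_surj.
move=> z; rewrite -(linear0 (quotmod_proj : {linear U -> quotmod_type})).
by rewrite -[X in _ <-> N X]subr0; exact: quotmod_projP.
Qed.

End SubQuotient.

(** ** Segments of a path *)

Section Segments.
Variables (K : fieldType) (G : quiver).
Implicit Types (p q r : qpath G) (a b c : nat).

Lemma qpath_eq p q : pstart p = pstart q -> parrows p = parrows q -> p = q.
Proof.
move=> s t; apply: val_inj; rewrite [LHS]surjective_pairing [RHS]surjective_pairing.
by congr (_, _).
Qed.

Definition vert p a : vertex G := last (pstart p) (map (@tgt G) (take a (parrows p))).

Fact is_path_seg p a b : is_path (vert p a) (take (b - a) (drop a (parrows p))).
Proof.
have := valP p; rewrite -/(pstart p) -/(parrows p).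
rewrite -[parrows p in X in X -> _](cat_take_drop a) is_path_cat => /andP[_].
rewrite -/(vert p a) -[drop a _ in X in X -> _](cat_take_drop (b - a)).
by rewrite is_path_cat => /andP[].
Qed.
Definition seg p a b : qpath G := @QPath G (_, _) (is_path_seg p a b).

Lemma pstart_seg p a b : pstart (seg p a b) = vert p a. Proof. by []. Qed.
Lemma parrows_seg p a b : parrows (seg p a b) = take (b - a) (drop a (parrows p)).
Proof. by []. Qed.
Lemma plen_seg p a b : (b <= plen p)%N -> plen (seg p a b) = (b - a)%N.
Proof.
move=> le; rewrite /plen parrows_seg size_takel // size_drop; exact: leq_sub2r.
Qed.
Lemma vert0 p : vert p 0 = pstart p. Proof. by rewrite /vert take0. Qed.
Lemma parrows_seg0 p b : parrows (seg p 0 b) = take b (parrows p).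
Proof. by rewrite parrows_seg drop0 subn0. Qed.
Lemma take_split (T : Type) (s : seq T) a b : (a <= b)%N ->
  take b s = take a s ++ take (b - a) (drop a s).
Proof.
by move=> le; rewrite -[LHS](cat_take_drop a) take_takel // take_drop subnK.
Qed.
Lemma pend_seg p a b : (a <= b)%N -> pend (seg p a b) = vert p b.
Proof.
move=> le; rewrite /pend pstart_seg parrows_seg /vert (take_split _ le) map_cat.
by rewrite last_cat.
Qed.
Lemma seg_full p : seg p 0 (plen p) = p.
Proof. by apply: qpath_eq; rewrite ?pstart_seg ?vert0 // parrows_seg0 take_size. Qed.
Lemma seg0 p : seg p 0 0 = vertex_path (pstart p).
Proof. by apply: qpath_eq; rewrite ?pstart_seg ?vert0 // parrows_seg0 take0. Qed.
Lemma vert_seg p a b i : (a + i <= b)%N -> vert (seg p a b) i = vert p (a + i).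
Proof.
move=> le; rewrite /vert pstart_seg parrows_seg take_takel; last first.
  by rewrite leq_subRL // (leq_trans (leq_addr _ _) le).
by rewrite (@take_split _ _ a (a + i)) ?leq_addr // addKn map_cat last_cat.
Qed.
Lemma seg_seg p a b i : (a + i <= b)%N ->
  path_elt K (seg (seg p a b) 0 i) = path_elt K (seg p a (a + i)).
Proof.
move=> le; congr path_elt; apply: qpath_eq.
  by rewrite pstart_seg vert_seg ?addn0 // (leq_trans (leq_addr i _) le).
rewrite parrows_seg0 !parrows_seg take_takel ?addKn //.
by rewrite leq_subRL // (leq_trans (leq_addr _ _) le).
Qed.
Lemma seg_arrow p a (a0 : arrow G) : (a < plen p)%N ->
  seg p a a.+1 = arrow_path (nth a0 (parrows p) a).
Proof.
move=> lt; have E : take (a.+1 - a) (drop a (parrows p)) = [:: nth a0 (parrows p) a].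
  by rewrite subSn // subnn (drop_nth a0) //= take0.
apply: qpath_eq; rewrite ?parrows_seg //; have := is_path_seg p a a.+1.
by rewrite E /= andbT => /eqP/esym.
Qed.
Lemma vertS p a (a0 : arrow G) : (a < plen p)%N ->
  vert p a.+1 = tgt (nth a0 (parrows p) a).
Proof. by move=> lt; rewrite /vert (take_nth a0) // map_rcons last_rcons. Qed.
Lemma vert_src p a (a0 : arrow G) : (a < plen p)%N ->
  vert p a = src (nth a0 (parrows p) a).
Proof. by move=> lt; rewrite -(pstart_seg p a a.+1) (seg_arrow a0 lt). Qed.

Lemma path_eltS q p r : pcomp q p = Some r -> path_elt K q * path_elt K p = path_elt K r.
Proof. by rewrite path_eltM => ->. Qed.
Lemma path_elt0 q p : pend p <> pstart q -> path_elt K q * path_elt K p = 0.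
Proof. by rewrite path_eltM /pcomp => /eqP/negPf->. Qed.

Lemma seg_mul p a b c : (a <= b)%N -> (b <= c)%N ->
  path_elt K (seg p b c) * path_elt K (seg p a b) = path_elt K (seg p a c).
Proof.
move=> ab bc; apply: path_eltS; apply/pcompP; rewrite pend_seg //; split=> //.
rewrite !parrows_seg (@take_split _ _ (b - a) (c - a)) ?leq_sub2r // drop_drop.
by rewrite subnK // subnBA // subnK // (leq_trans ab).
Qed.

Lemma path_elt_rcons q s (a : arrow G) : parrows q = rcons s a ->
  exists2 q', parrows q' = s /\ pstart q' = pstart q
            & path_elt K q = path_elt K (arrow_path a) * path_elt K q'.
Proof.
move=> E; have szs : plen q = (size s).+1 by rewrite /plen E size_rcons.
exists (seg q 0 (size s)); first by rewrite pstart_seg vert0 parrows_seg0 E -cats1 take_size_cat.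
rewrite -[in LHS](seg_full q) szs -(@seg_mul _ 0 (size s)) // (seg_arrow a) ?szs //.
by rewrite E nth_rcons ltnn eqxx.
Qed.

Lemma mcoeff_path_elt p q : monalg.mcoeff q (path_elt K p) = (p == q)%:R.
Proof. by rewrite path_elt.unlock monalg.mcoeffU. Qed.

Lemma mcoeff_lin q (k : K) (f g : path_algebra K G) :
  monalg.mcoeff q (k *: f + g) = k * monalg.mcoeff q f + monalg.mcoeff q g.
Proof. by rewrite monalg.mcoeffD monalg.mcoeffZ. Qed.

(** Condition (N) provides an element [c] of the path algebra. A nonzero coefficient at [q] forces
    some path occurring in [c] to complete [p] to [q]. *)
Lemma mcoeff_mulr (c : path_algebra K G) p q : monalg.mcoeff q (c * path_elt K p) != 0 ->
  exists r, pcomp r p = Some q.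
Proof.
apply: contra_neqP => nex.
elim/path_algebra_ind: c => [|k f g IHf IHg|r]; first by rewrite mul0r monalg.mcoeff0.
  by rewrite mulrDl -path_scalerAl mcoeff_lin IHf IHg mulr0 addr0.
rewrite path_eltM; case E: (pcomp r p) => [t|] /=; last by rewrite monalg.mcoeff0.
by rewrite mcoeff_path_elt; case: eqP => // tq; case: nex; exists r; rewrite E tq.
Qed.

Lemma mcoeff_mull (c : path_algebra K G) p q : monalg.mcoeff q (path_elt K p * c) != 0 ->
  exists r, pcomp p r = Some q.
Proof.
apply: contra_neqP => nex.
elim/path_algebra_ind: c => [|k f g IHf IHg|r]; first by rewrite mulr0 monalg.mcoeff0.
  by rewrite mulrDr -path_scalerAr mcoeff_lin IHf IHg mulr0 addr0.
rewrite path_eltM; case E: (pcomp p r) => [t|] /=; last by rewrite monalg.mcoeff0.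
by rewrite mcoeff_path_elt; case: eqP => // tq; case: nex; exists r; rewrite E tq.
Qed.
End Segments.

(** ** The path algebra acting on a module *)

(* Modules are over the quotient algebra only, so K acts through the scalar
   multiples of 1.  Locked to keep unification from unfolding the quotient. *)
HB.lock Definition smul (K : fieldType) (G : quiver) (I : ideal (path_algebra K G))
    (U : lmodType (quot_algebra I)) (c : K) (z : U) : U :=
  quot_class I (c *: (1 : path_algebra K G)) *: z.

Section Action.
Variables (K : fieldType) (G : quiver) (I : ideal (path_algebra K G)).
Local Notation Lam := (quot_algebra I).
Local Notation pc := (path_class I).
Implicit Types (U W : lmodType Lam).

Lemma smulE U c (z : U) : smul c z = quot_class I (c *: (1 : path_algebra K G)) *: z.
Proof. by rewrite smul.unlock. Qed.

Lemma quot_classM (f g : path_algebra K G) :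
  quot_class I (f * g) = quot_class I f * quot_class I g.
Proof. exact: (rmorphM (quot_proj I)). Qed.
Lemma quot_classD (f g : path_algebra K G) :
  quot_class I (f + g) = quot_class I f + quot_class I g.
Proof. exact: (raddfD (quot_proj I)). Qed.
Lemma quot_class0 : quot_class I 0 = 0.
Proof. exact: (raddf0 (quot_proj I)). Qed.
Lemma quot_class1 : quot_class I 1 = 1.
Proof. exact: (rmorph1 (quot_proj I)). Qed.
Lemma quot_class_surj (a : Lam) : exists f, quot_class I f = a.
Proof. exact: quot_proj_surj. Qed.

Lemma quot_classZ U c (f : path_algebra K G) (z : U) :
  quot_class I (c *: f) *: z = smul c (quot_class I f *: z).
Proof.
have E : (c *: (1 : path_algebra K G)) * f = c *: f by rewrite -path_scalerAl mul1r.
by rewrite smul.unlock -E quot_classM scalerA.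
Qed.

Lemma smul_comm U (a : Lam) c (z : U) : a *: smul c z = smul c (a *: z).
Proof.
have [f <-] := quot_class_surj a.
rewrite smul.unlock !scalerA -!quot_classM -path_scalerAl mul1r.
by rewrite -path_scalerAr mulr1.
Qed.
Lemma smulDr U c (x y : U) : smul c (x + y) = smul c x + smul c y.
Proof. by rewrite smul.unlock scalerDr. Qed.
Lemma smulr0 U c : smul c (0 : U) = 0.
Proof. by rewrite smul.unlock scaler0. Qed.
Lemma smulDl U c d (z : U) : smul (c + d) z = smul c z + smul d z.
Proof. by rewrite smul.unlock scalerDl quot_classD scalerDl. Qed.
Lemma smul0 U (z : U) : smul 0 z = 0.
Proof. by rewrite smul.unlock scale0r quot_class0 scale0r. Qed.
Lemma smul1 U (z : U) : smul 1 z = z.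
Proof. by rewrite smul.unlock scale1r quot_class1 scale1r. Qed.
Lemma smulA U c d (z : U) : smul c (smul d z) = smul (c * d) z.
Proof.
have E : (c * d) *: (1 : path_algebra K G) = c *: (d *: (1 : path_algebra K G)).
  exact/esym/scalerA.
by rewrite [RHS]smulE E quot_classZ -smulE.
Qed.
Lemma smul_sum U c (T : Type) (r : seq T) (P : pred T) (F : T -> U) :
  smul c (\sum_(i <- r | P i) F i) = \sum_(i <- r | P i) smul c (F i).
Proof. by rewrite smul.unlock scaler_sumr. Qed.
Lemma smul_suml U (T : Type) (r : seq T) (P : pred T) (F : T -> K) (z : U) :
  smul (\sum_(i <- r | P i) F i) z = \sum_(i <- r | P i) smul (F i) z.
Proof.
apply: (big_morph (fun c => smul c z)) => [c d|]; [exact: smulDl|exact: smul0].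
Qed.
Lemma smulN U c (z : U) : smul (- c) z = - smul c z.
Proof. by apply/eqP; rewrite -addr_eq0 -smulDl addNr smul0. Qed.
Lemma smul_inv U c (z w : U) : c != 0 -> smul c z = w -> z = smul c^-1 w.
Proof. by move=> nz <-; rewrite smulA mulVf // smul1. Qed.

(** Without the start vertex, induction on the list of arrows is possible. For positive length
    nothing is lost, since the first arrow absorbs the start idempotent. *)
Definition arrow_act U (s : seq (arrow G)) (z : U) : U :=
  foldl (fun z a => pc (arrow_path a) *: z) z s.

Lemma path_class_act U q (z : U) :
  pc q *: z = arrow_act (parrows q) (pc (vertex_path (pstart q)) *: z).
Proof.
move E: (parrows q) => s; elim/last_ind: s => [|s a IHs] in q E *.
  by congr (path_class I _ *: _); apply: qpath_eq.
have [q' [Eq' sq'] Eq] := path_elt_rcons K E.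
rewrite /path_class Eq quot_classM -scalerA -/(path_class I q') (IHs q') //.
by rewrite sq' /arrow_act foldl_rcons.
Qed.

Lemma arrow_act_path U q (z : U) : (0 < plen q)%N ->
  pc q *: z = arrow_act (parrows q) z.
Proof.
have := valP q; rewrite -/(pstart q) -/(parrows q) /plen => + gt0; rewrite path_class_act.
case: (parrows q) gt0 => //= a s _ /andP[/eqP srca _]; congr foldl.
rewrite scalerA -quot_classM (@path_eltS K _ _ _ (arrow_path a)) //.
by apply/pcompP; split.
Qed.

Lemma sum_vertices U (z : U) : z = \sum_(e : vertex G) pc (vertex_path e) *: z.
Proof.
rewrite -scaler_suml -[LHS]scale1r -quot_class1; congr (_ *: _).
exact: (raddf_sum (quot_proj I)).
Qed.

Lemma submoduleD U (N : set U) : submodule N -> forall x y, N x -> N y -> N (x + y).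
Proof. by case=> _ NL x y Nx Ny; rewrite -[x]scale1r; exact: NL. Qed.
Lemma submoduleZ U (N : set U) : submodule N -> forall a x, N x -> N (a *: x).
Proof. by case=> N0 NL a x Nx; rewrite -[a *: x]addr0; exact: NL. Qed.
Lemma submodule_smul U (N : set U) : submodule N -> forall c x, N x -> N (smul c x).
Proof. by move=> HN c x Nx; rewrite smul.unlock; exact: submoduleZ. Qed.
Lemma submodule_sum U (N : set U) (T : Type) (r : seq T) (P : pred T) (F : T -> U) :
  submodule N -> (forall i, P i -> N (F i)) -> N (\sum_(i <- r | P i) F i).
Proof.
by move=> HN NF; apply: (big_ind N) => //; [case: HN|exact: submoduleD].
Qed.

(** The classes of paths span the algebra over K. *)
Lemma submodule_paths U (N : set U) : N 0 ->
  (forall x y, N x -> N y -> N (x + y)) -> (forall c x, N x -> N (smul c x)) ->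
  (forall q x, N x -> N (pc q *: x)) -> submodule N.
Proof.
move=> N0 ND NZ Nq; split=> // a x y Nx Ny; apply: (ND) => //.
have [f <-] := quot_class_surj a.
elim/path_algebra_ind: f => [|c f g IHf IHg|q]; last exact: Nq.
  by rewrite quot_class0 scale0r.
by rewrite quot_classD scalerDl quot_classZ; apply: ND => //; apply: NZ.
Qed.

Lemma linear_smul U W (f : {linear U -> W}) c z : f (smul c z) = smul c (f z).
Proof. by rewrite smul.unlock linearZ. Qed.

End Action.

(** ** Bases along a mast *)

Section Spine.
Variables (K : fieldType) (G : quiver) (I : ideal (path_algebra K G)).
Local Notation Lam := (quot_algebra I).
Local Notation pc := (path_class I).
Implicit Types (U W : lmodType Lam) (p : qpath G).

Definition spine_elt U p (x : U) j : U := pc (seg p 0 j) *: x.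

Definition comb U p (x : U) (c : nat -> K) : U :=
  \sum_(i < (plen p).+1) smul (c i) (spine_elt p x i).

Definition spanned U p (x : U) (S : nat -> Prop) (z : U) : Prop :=
  exists2 c, (forall i, ~ S i -> c i = 0) & z = comb p x c.

(** Linear independence of the [spine_elt p x j] is left out: it follows from the raising property
    and the nonvanishing of the last one ([comb_inj0]). *)
Definition spine U p (x : U) : Prop :=
  [/\ pc (vertex_path (pstart p)) *: x = x, forall z, exists c, z = comb p x c,
      forall a j, (j <= plen p)%N ->
        spanned p x (fun i => (j < i)%N) (pc (arrow_path a) *: spine_elt p x j)
    & spine_elt p x (plen p) <> 0].

Section Span.
Variables (U : lmodType Lam) (p : qpath G) (x : U).
Local Notation b := (spine_elt p x).
Local Notation cb := (comb p x).
Local Notation sp := (spanned p x).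
Local Notation l := (plen p).
Implicit Types (S T : nat -> Prop).

Lemma combD c d : cb c + cb d = cb (fun i => c i + d i).
Proof. by rewrite -big_split; apply: eq_bigr => i _; rewrite smulDl. Qed.
Lemma combZ k c : smul k (cb c) = cb (fun i => k * c i).
Proof. by rewrite smul_sum; apply: eq_bigr => i _; rewrite smulA. Qed.
Lemma comb0 c : (forall i, (i <= l)%N -> c i = 0) -> cb c = 0.
Proof. by move=> c0; rewrite /comb big1 // => i _; rewrite c0 ?smul0 // -ltnS. Qed.
Lemma comb_delta i : (i <= l)%N -> b i = cb (fun j => (j == i)%:R).
Proof.
rewrite -ltnS => lt; rewrite /comb (bigD1 (Ordinal lt)) //= eqxx smul1 big1 ?addr0 //.
by move=> j; rewrite -val_eqE /= => /negPf->; rewrite smul0.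
Qed.

Lemma spanned0 S : sp S 0.
Proof. by exists (fun=> 0) => //; rewrite comb0. Qed.
Lemma spannedD S y z : sp S y -> sp S z -> sp S (y + z).
Proof.
move=> [c c0 ->] [d d0 ->]; rewrite combD; exists (fun i => c i + d i) => // i nS.
by rewrite c0 // d0 // addr0.
Qed.
Lemma spannedZ S k z : sp S z -> sp S (smul k z).
Proof.
move=> [c c0 ->]; rewrite combZ; exists (fun i => k * c i) => // i nS.
by rewrite c0 // mulr0.
Qed.
Lemma spanned_sum S (J : Type) (r : seq J) (P : pred J) (F : J -> U) :
  (forall i, P i -> sp S (F i)) -> sp S (\sum_(i <- r | P i) F i).
Proof. by move=> SF; apply: big_ind => //; [exact: spanned0|exact: spannedD]. Qed.
Lemma spanned_elt S i : (i <= l)%N -> S i -> sp S (b i).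
Proof.
move=> le Si; rewrite comb_delta //; exists (fun j => (j == i)%:R) => // j nS.
by case: eqP nS => // ->.
Qed.
Lemma spannedW S T z : (forall i, (i <= l)%N -> S i -> T i) -> sp S z -> sp T z.
Proof.
move=> ST [c c0 ->]; apply: spanned_sum => i _.
have [Si|nS] := pselect (S i); last by rewrite c0 // smul0; exact: spanned0.
have le : (i <= l)%N by rewrite -ltnS.
by apply: spannedZ; apply: spanned_elt => //; exact: ST.
Qed.
Lemma spanned_scale S T a z :
  (forall i, (i <= l)%N -> S i -> sp T (a *: b i)) -> sp S z -> sp T (a *: z).
Proof.
move=> ST [c c0 ->]; rewrite /comb scaler_sumr; apply: spanned_sum => i _.
rewrite smul_comm; have [Si|nS] := pselect (S i).
  by apply: spannedZ; apply: ST => //; rewrite -ltnS.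
by rewrite c0 // smul0; exact: spanned0.
Qed.
Lemma spanned_empty S z : (forall i, (i <= l)%N -> ~ S i) -> sp S z -> z = 0.
Proof. by move=> S0 [c c0 ->]; apply: comb0 => i /S0/c0. Qed.

Lemma seg_spine_elt i j : (i <= j)%N -> pc (seg p i j) *: b i = b j.
Proof. by move=> le; rewrite scalerA -quot_classM seg_mul. Qed.

Lemma vertex_spine_elt e i :
  pc (vertex_path e) *: b i = if vert p i == e then b i else 0.
Proof.
rewrite scalerA -quot_classM; case: eqP => [<-|ne].
  rewrite (@path_eltS K _ _ _ (seg p 0 i)) //; apply/pcompP.
  by rewrite pend_seg // cats0; split.
by rewrite path_elt0 ?quot_class0 ?scale0r // pend_seg.
Qed.

Lemma vertex_comb e c : pc (vertex_path e) *: cb c =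
  cb (fun i => if vert p i == e then c i else 0).
Proof.
rewrite scaler_sumr; apply: eq_bigr => i _; rewrite smul_comm vertex_spine_elt.
by case: ifP => // _; rewrite smulr0 smul0.
Qed.

Lemma spanned_vertex e S z : sp S z ->
  sp (fun i => S i /\ vert p i = e) (pc (vertex_path e) *: z).
Proof.
move=> [c c0 ->]; rewrite vertex_comb; eexists; last by [].
by move=> i /= nS; case: eqP => // E; apply: c0 => Si; apply: nS.
Qed.

Hypothesis Hx : spine p x.

Lemma spine0 : b 0 = x.
Proof. by case: Hx => Ex _ _ _; rewrite /spine_elt seg0. Qed.

Lemma arrows_raise s j z : sp (fun i => (j <= i)%N) z ->
  sp (fun i => (j + size s <= i)%N) (arrow_act s z).
Proof.
elim/last_ind: s => [|s a IHs]; first by rewrite addn0.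
move/IHs; rewrite /arrow_act foldl_rcons size_rcons addnS.
apply: spanned_scale => i il le; case: Hx => _ _ /(_ a i il) + _.
by apply: spannedW => h _; exact: leq_ltn_trans.
Qed.

Lemma path_raise q j z : sp (fun i => (j <= i)%N) z ->
  sp (fun i => (j + plen q <= i)%N) (pc q *: z).
Proof.
move=> Hz; rewrite path_class_act; apply: arrows_raise.
by apply: spannedW (spanned_vertex _ Hz) => i _ [].
Qed.

(** The segment carries the element at position [j] to the one at [h], and raises every later one by
    at least [h - j], hence past [h]. *)
Lemma seg_comb c j h : (j <= h)%N -> (h <= l)%N -> (forall i, (i < j)%N -> c i = 0) ->
  exists2 z, sp (fun i => (h < i)%N) z & pc (seg p j h) *: cb c = smul (c j) (b h) + z.
Proof.
move=> jh hl c0; have jl : (j < l.+1)%N by rewrite ltnS (leq_trans jh).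
rewrite /comb (bigD1 (Ordinal jl)) //= scalerDr smul_comm seg_spine_elt //.
eexists; last by []; rewrite scaler_sumr; apply: spanned_sum => i.
rewrite -val_eqE /= => ne; rewrite smul_comm.
have [lt|] := ltnP i j; first by rewrite c0 // smul0; exact: spanned0.
rewrite leq_eqVlt eq_sym (negPf ne) /= => lt; apply: spannedZ.
have il : (i <= l)%N by rewrite -ltnS.
have := @path_raise (seg p j h) i (b i).
move/(_ (spanned_elt il (leqnn i))); rewrite plen_seg //.
by apply: spannedW => m _; apply: leq_trans; rewrite -{1}(subnKC jh) -addSn leq_add2r.
Qed.

(** At the lowest position with a nonzero coefficient, the segment of [p] leading from there to the
    end leaves only that coefficient times the nonzero last element. *)
Lemma comb_inj0 c : cb c = 0 -> forall i, (i <= l)%N -> c i = 0.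
Proof.
move=> cz i; elim/ltn_ind: i => i IHi il.
have c0 h : (h < i)%N -> c h = 0.
  by move=> hi; apply: IHi => //; rewrite ltnW // (leq_trans hi).
have [z /spanned_empty Hz] := seg_comb il (leqnn l) c0.
rewrite cz scaler0 Hz ?addr0 => [/esym E|h]; last by rewrite ltnNge => hl /negP.
apply/eqP/negPn/negP => nz; case: Hx => _ _ _; apply.
by rewrite (smul_inv nz E) smulr0.
Qed.

Lemma comb_inj c d : cb c = cb d -> forall i, (i <= l)%N -> c i = d i.
Proof.
move=> E i il; apply/eqP; rewrite -subr_eq0; apply/eqP.
apply: (comb_inj0 (c := fun i => c i - d i)) il.
have -> : cb (fun i => c i - d i) = cb c + smul (-1) (cb d).
  by rewrite combZ combD; apply: eq_bigr => h _; rewrite mulN1r.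
by rewrite E smulN smul1 subrr.
Qed.

Lemma spanned_comb S c i : sp S (cb c) -> (i <= l)%N -> ~ S i -> c i = 0.
Proof. by move=> [d d0 E] il nS; rewrite (comb_inj E il) d0. Qed.

(** Segments starting at [j] turn the given element into one with leading position any [h >= j]; the
    terms past [h] are removed by induction from the end. *)
Lemma submodule_spine (N : set U) c j : submodule N -> N (cb c) -> (j <= l)%N ->
  (forall i, (i < j)%N -> c i = 0) -> c j != 0 ->
  forall z, sp (fun i => (j <= i)%N) z -> N z.
Proof.
move=> HN Nc jl c0 cj.
(* Here [h] counts positions from the end of [p]. *)
have Nsp h : (h <= l.+1)%N -> forall z, (j <= l.+1 - h)%N ->
    sp (fun i => (l.+1 - h <= i)%N) z -> N z.
  elim: h => [_ z _ Hz|h IHh hl z jh].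
    rewrite (spanned_empty _ Hz); first by case: HN.
    by move=> i il; rewrite subn0 ltnNge il.
  have Nspb y : sp (fun i => (l.+1 - h.+1 < i)%N) y -> N y.
    rewrite subSS -subSn // => Hy; apply: IHh Hy; first exact: ltnW.
    by rewrite subSS in jh; rewrite subSn // leqW.
  have lhl : (l.+1 - h.+1 <= l)%N by rewrite subSS leq_subr.
  have Nb : N (b (l.+1 - h.+1)%N).
    have [y Hy E] := seg_comb jh lhl c0.
    have := submoduleZ HN (pc (seg p j (l.+1 - h.+1))) Nc; rewrite E => Nbz.
    have Eb : smul (c j) (b (l.+1 - h.+1)) =
        (smul (c j) (b (l.+1 - h.+1)) + y) + smul (-1) y.
      by rewrite smulN smul1 addrK.
    rewrite (smul_inv cj Eb).
    apply: submodule_smul => //; apply: submoduleD => //; apply: submodule_smul => //.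
    exact: Nspb.
  case=> d d0 ->; apply: submodule_sum => // i _.
  have il : (i <= l)%N by rewrite -ltnS.
  case: (ltngtP i (l.+1 - h.+1)) => [lt|gt|->]; last exact: submodule_smul.
    by rewrite d0 ?smul0; [case: HN|rewrite leqNgt => /negP].
  by apply: submodule_smul => //; apply: Nspb; exact: spanned_elt.
move=> z Hz; apply: (Nsp (l.+1 - j)%N); rewrite ?leq_subr ?subKn //; exact: leqW.
Qed.
End Span.
End Spine.

(** * Submodules and subquotients of a module with a spine *)

Section SpineUniserial.
Variables (K : fieldType) (G : quiver) (I : ideal (path_algebra K G)).
Local Notation Lam := (quot_algebra I).
Local Notation pc := (path_class I).
Implicit Types (U W : lmodType Lam) (p : qpath G).

Definition layer U p (x : U) j : set U := spanned p x (fun i => (j <= i)%N).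

Lemma layer_submodule U p (x : U) j : spine p x -> submodule (layer p x j).
Proof.
move=> Hx; apply: submodule_paths.
- exact: spanned0.
- exact: spannedD.
- exact: spannedZ.
- move=> q z /(path_raise Hx q); apply: spannedW => i _.
  by apply: leq_trans; exact: leq_addr.
Qed.

Lemma layerS U p (x : U) i j : (i <= j)%N -> layer p x j `<=` layer p x i.
Proof. by move=> ij z; apply: spannedW => h _; exact: leq_trans. Qed.

(** A submodule is determined by the least position at which one of its elements has a nonzero
    coefficient. *)
Lemma submodule_layer U p (x : U) (N : set U) : spine p x -> submodule N ->
  exists2 j, (j <= (plen p).+1)%N & N = layer p x j.
Proof.
move=> Hx HN; have spanx z : exists c, z = comb p x c by case: Hx.
(* If no [j] satisfies [Q], then [N] is zero, which is the layer numbered [(plen p).+1]. *)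
pose Q j := `[< exists2 c, N (comb p x c) & c j != 0 >] && (j <= plen p)%N.
have Q0 j : (forall i, (i < j)%N -> ~~ Q i) -> (j <= (plen p).+1)%N ->
    forall c, N (comb p x c) -> forall i, (i < j)%N -> c i = 0.
  move=> nQ jl c Nc i ij; apply/eqP/negPn/negP => nz; have /negP := nQ _ ij; apply.
  rewrite /Q -ltnS (leq_trans ij jl) andbT; apply/asboolP; by exists c.
have NF j : (forall i, (i < j)%N -> ~~ Q i) -> (j <= (plen p).+1)%N ->
    N `<=` layer p x j.
  move=> nQ jl z Nz; have [c Ec] := spanx z; rewrite Ec in Nz *.
  have c0 := Q0 _ nQ jl _ Nz; exists (fun i => if (i < j)%N then 0 else c i).
    by move=> i /negP; rewrite -ltnNge => ->.
  by apply: eq_bigr => i _; case: ifP => [/c0 ->|_].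
have [exQ|nQ] := pselect (exists j, Q j); last first.
  exists (plen p).+1 => //; apply/seteqP; split.
    by apply: NF => // i _; apply/negP => Qi; apply: nQ; exists i.
  move=> z Hz; rewrite (spanned_empty _ Hz); first by case: HN.
  by move=> i il; rewrite ltnNge il.
case: (ex_minnP exQ) => j /andP[/asboolP[c Nc cj] jl] jmin.
have nQ i : (i < j)%N -> ~~ Q i by rewrite ltnNge; apply: contra => /jmin.
exists j; first exact: leqW.
apply/seteqP; split; first by apply: NF => //; exact: leqW.
exact: (submodule_spine Hx HN Nc jl (Q0 j nQ (leqW jl) c Nc) cj).
Qed.

Lemma layer0 U p (x : U) : spine p x -> layer p x 0 = setT.
Proof.
case=> _ spanx _ _; apply/seteqP; split=> // z _; have [c ->] := spanx z.
by exists c.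
Qed.

Lemma layer_last U p (x : U) : layer p x (plen p).+1 = [set 0].
Proof.
apply/seteqP; split=> z => [Hz|->]; last exact: spanned0.
by rewrite (spanned_empty _ Hz) // => i il; rewrite ltnNge il.
Qed.

Lemma spine_elt_layer U p (x : U) i j : spine p x -> (i <= plen p)%N ->
  layer p x j (spine_elt p x i) -> (j <= i)%N.
Proof.
move=> Hx il; rewrite (comb_delta x il) => /(spanned_comb Hx)/(_ il) H.
rewrite leqNgt; apply/negP => ij; suff /eqP : (i == i)%:R = 0 :> K by rewrite eqxx oner_eq0.
by apply: H; rewrite leqNgt ij.
Qed.

Lemma spine_uniserial U p (x : U) : spine p x -> uniserial_with_mast p U.
Proof.
move=> Hx; split; last by exists x; rewrite -[p in pc p]seg_full; case: Hx.
  split.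
    exists [:: x] => N HN /(_ x (mem_head _ _)) Nx.
    have [j _ Ej] := submodule_layer Hx HN; rewrite Ej in Nx *.
    have Nx0 : layer p x j (spine_elt p x 0) by rewrite (spine0 Hx).
    have := spine_elt_layer Hx (leq0n _) Nx0.
    by rewrite leqn0 => /eqP->; exact: layer0.
  move=> N N' HN HN'.
  have [j _ ->] := submodule_layer Hx HN; have [i _ ->] := submodule_layer Hx HN'.
  by case/orP: (leq_total i j) => /layerS; [left|right].
(* The composition series consists of the layers, numbered from the end. *)
exists (fun i => layer p x ((plen p).+1 - i)); split.
- by rewrite subn0 layer_last.
- by rewrite subnn layer0.
- by move=> i _; exact: layer_submodule.
move=> i il; have il' : ((plen p).+1 - i.+1 <= plen p)%N by rewrite subSS leq_subr.
have -> : ((plen p).+1 - i)%N = ((plen p).+1 - i.+1).+1 by rewrite subSS subSn.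
move: (_ - _)%N il' => j jl; split.
  split; first exact: layerS.
  by move=> /(_ _ (spanned_elt x jl (leqnn j)))/(spine_elt_layer Hx jl); rewrite ltnn.
move=> L HL; have [h _ ->] := submodule_layer Hx HL => F1 F2.
have jh : (j <= h)%N.
  have [hl|] := leqP h (plen p); last by move=> ?; rewrite (leq_trans jl) // ltnW.
  by apply: (spine_elt_layer Hx hl); apply: F2; exact: spanned_elt.
move: jh; rewrite leq_eqVlt => /orP[/eqP->|jh]; first by right.
left; apply/seteqP; split => //; exact: layerS.
Qed.

(** The module sought is layer [i] modulo layer [j.+1], and [y] is the image of the basis element at
    position [i]. *)
Lemma spine_seg U p (x : U) i j : spine p x -> (i <= j)%N -> (j <= plen p)%N ->
  exists (W : lmodType Lam) (y : W), spine (seg p i j) y.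
Proof.
move=> Hx ij jl; have il := leq_trans ij jl.
have [S [f [f_inj fN]]] := submodule_lmod (layer_submodule i Hx).
have HN' : submodule [set s | layer p x j.+1 (f s)].
  split=> [|a s t /= Ns Nt]; first by rewrite /= linear0; exact: spanned0.
  by rewrite /= linearP; case: (layer_submodule j.+1 Hx) => _; apply.
have [W [g [g_surj gN]]] := quotient_lmod HN'.
(* The lift is constrained only for positions on [p]; elsewhere it defaults to 0. *)
have sb k : exists s, (i + k <= plen p)%N -> f s = spine_elt p x (i + k).
  have [le|nle] := boolP (i + k <= plen p)%N; last by exists 0.
  have /fN[s Es] : layer p x i (spine_elt p x (i + k)) by apply: spanned_elt => //; exact: leq_addr.
  by exists s.
have [s Es] := choice sb.
have gs k : (j < i + k)%N -> (i + k <= plen p)%N -> g (s k) = 0.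
  by move=> jk kl; apply/gN; rewrite /= Es //; exact: spanned_elt.
have Eb k : (i + k <= j)%N -> spine_elt (seg p i j) (g (s 0)) k = g (s k).
  move=> le; rewrite /spine_elt /path_class seg_seg // -/(path_class I _) -linearZ /=.
  congr (g _); apply: f_inj; have le' := leq_trans le jl.
  by rewrite linearZ /= !Es ?addn0 // seg_spine_elt // leq_addr.
have Ej : plen (seg p i j) = (j - i)%N by rewrite plen_seg.
(* Expand in the lifts [s k]: those up to position [j] give the new basis, the later ones die in
   [W]. *)
have spanW m (t : S) : layer p x (i + m) (f t) ->
    spanned (seg p i j) (g (s 0)) (fun k => (m <= k)%N) (g t).
  case=> c c0 Et.
  have -> : t = \sum_(k < (plen p - i).+1) smul (c (i + k)%N) (s k).
    apply: f_inj; rewrite Et linear_sum /comb /=.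
    rewrite -(big_mkord xpredT (fun k => smul (c k) (spine_elt p x k))).
    rewrite (big_cat_nat (n := i)) //=; last exact: leqW.
    rewrite big_nat big1 ?add0r => [|h /andP[_ hi]]; last first.
      by rewrite c0 ?smul0 // => /(leq_trans (leq_addr _ _)); rewrite leqNgt hi.
    rewrite -{1}[i]add0n big_addn subSn // big_mkord; apply: eq_bigr => k _.
    rewrite linear_smul addnC Es // -leq_subRL // -ltnS; exact: ltn_ord.
  rewrite linear_sum; apply: spanned_sum => k _ /=; rewrite linear_smul.
  have kl : (i + k <= plen p)%N by rewrite -leq_subRL // -ltnS; exact: ltn_ord.
  have [mk|km] := leqP m k; last first.
    by rewrite c0 ?smul0; [exact: (spanned0 (U := W))|rewrite leq_add2l leqNgt km].
  apply: (spannedZ (U := W)); have [kj|jk] := leqP (i + k) j.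
    by rewrite -(Eb k) //; apply: (spanned_elt (U := W)) => //; rewrite Ej leq_subRL.
  by rewrite (gs k) //; exact: (spanned0 (U := W)).
exists W, (g (s 0)); split.
- rewrite -[RHS]Eb ?addn0 // /spine_elt /path_class.
  by congr (quot_class I _ *: _); rewrite seg0.
- move=> w; have [t <-] := g_surj w.
  have [|c _ ->] := spanW 0 t; last by exists c.
  by rewrite addn0; apply/fN; exists t.
- move=> a k; rewrite Ej => kj; have ikj : (i + k <= j)%N by rewrite -leq_subRL.
  rewrite Eb // -linearZ /=; apply: (spanW k.+1); rewrite linearZ /= Es ?(leq_trans ikj) //.
  by rewrite addnS; case: Hx => _ _ /(_ a _ (leq_trans ikj jl)).
- rewrite Ej Eb ?subnKC // => /gN /=; rewrite Es subnKC // => /(spine_elt_layer Hx jl).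
  by rewrite ltnn.
Qed.

End SpineUniserial.

(** ** Top elements of uniserial modules *)

Section TopElements.
Variables (K : fieldType) (G : quiver) (I : ideal (path_algebra K G)).
Local Notation Lam := (quot_algebra I).
Local Notation pc := (path_class I).
Implicit Types (U W : lmodType Lam) (p q : qpath G).

(** For admissible [I] this is the [j]-th radical power of [U], generated as a K-space by the images
    under paths of length at least [j]. *)
Inductive path_layer U (j : nat) : U -> Prop :=
| path_layer0 : path_layer j 0
| path_layerD x y : path_layer j x -> path_layer j y -> path_layer j (x + y)
| path_layerZ c x : path_layer j x -> path_layer j (smul c x)
| path_layerP q t : (j <= plen q)%N -> path_layer j (pc q *: t).

Lemma path_layerS U i j (z : U) : (i <= j)%N -> path_layer j z -> path_layer i z.
Proof.
move=> ij; elim=> [|x y _ + _|c x _|q t jq]; first exact: path_layer0.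
- exact: path_layerD.
- exact: path_layerZ.
by apply: path_layerP; exact: leq_trans jq.
Qed.

Lemma plen_pcomp q p r : pcomp q p = Some r -> plen r = (plen p + plen q)%N.
Proof. by case/pcompP => _ _; rewrite /plen => ->; rewrite size_cat. Qed.

Lemma path_layer_act U j q (z : U) : path_layer j z -> path_layer (j + plen q) (pc q *: z).
Proof.
elim=> [|x y _ Hx _ Hy|c x _ Hx|r t jr]; first by rewrite scaler0; exact: path_layer0.
- by rewrite scalerDr; exact: path_layerD.
- by rewrite smul_comm; exact: path_layerZ.
rewrite scalerA -quot_classM path_eltM; case E: (pcomp q r) => [s|] /=.
  by apply: path_layerP; rewrite (plen_pcomp E) leq_add2r.
by rewrite quot_class0 scale0r; exact: path_layer0.
Qed.

Lemma aip_mcoeff n (f : path_algebra K G) : arrow_ideal_power n f <->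
  forall q, monalg.mcoeff q f != 0 -> (n <= plen q)%N.
Proof. by split=> H q; have := H q; rewrite monalg.mcoeff_neq0. Qed.

Lemma aip_lin n c (f g : path_algebra K G) :
  arrow_ideal_power n f -> arrow_ideal_power n g -> arrow_ideal_power n (c *: f + g).
Proof.
move=> /aip_mcoeff Hf /aip_mcoeff Hg; apply/aip_mcoeff => q.
rewrite mcoeff_lin; have [->|nz] := eqVneq (monalg.mcoeff q g) 0; last by move=> _; exact: Hg.
by rewrite addr0 mulf_eq0 negb_or => /andP[_]; exact: Hf.
Qed.
Lemma aip0 n : arrow_ideal_power n (0 : path_algebra K G).
Proof. by apply/aip_mcoeff => q; rewrite monalg.mcoeff0 eqxx. Qed.
Lemma aip_path n q : (n <= plen q)%N -> arrow_ideal_power n (path_elt K q).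
Proof.
move=> le; apply/aip_mcoeff => r; rewrite mcoeff_path_elt.
by case: (q =P r) => [<-|_] //; rewrite eqxx.
Qed.

Lemma aip_ind n (P : path_algebra K G -> Prop) : P 0 ->
  (forall c f g, P f -> P g -> P (c *: f + g)) ->
  (forall q, (n <= plen q)%N -> P (path_elt K q)) ->
  forall f, arrow_ideal_power n f -> P f.
Proof.
move=> P0 PD Pp f Hf; rewrite [f]path_algebraE big_seq.
by apply: big_rec => // q g /Hf le Pg; apply: PD => //; exact: Pp.
Qed.

Lemma aipM m n (f g : path_algebra K G) :
  arrow_ideal_power m f -> arrow_ideal_power n g -> arrow_ideal_power (m + n) (f * g).
Proof.
move=> Hf Hg; move: f Hf; apply: aip_ind => [|c f f' Hf Hf'|q mq].
- by rewrite mul0r; exact: aip0.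
- by rewrite mulrDl -path_scalerAl; exact: aip_lin.
move: g Hg; apply: aip_ind => [|c f f' Hf Hf'|r nr].
- by rewrite mulr0; exact: aip0.
- by rewrite mulrDr -path_scalerAr; exact: aip_lin.
rewrite path_eltM; case E: (pcomp q r) => [s|] /=; last exact: aip0.
by apply: aip_path; rewrite (plen_pcomp E) addnC leq_add.
Qed.

Lemma path_layer_aip U j n f (z : U) : arrow_ideal_power n f -> path_layer j z ->
  path_layer (j + n) (quot_class I f *: z).
Proof.
move=> Hf Hz; move: f Hf; apply: aip_ind => [|c f g Hf Hg|q nq].
- by rewrite quot_class0 scale0r; exact: path_layer0.
- rewrite quot_classD scalerDl quot_classZ; apply: path_layerD => //.
  exact: path_layerZ.
by apply: path_layerS (path_layer_act q Hz); rewrite leq_add2l.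
Qed.

Lemma vertex_decomposition (f : path_algebra K G) : exists (c : vertex G -> K) g,
  arrow_ideal_power 1 g /\ f = \sum_e c e *: path_elt K (vertex_path e) + g.
Proof.
elim/path_algebra_ind: f => [|k f f' [c [g [Hg ->]]] [c' [g' [Hg' ->]]]|q].
- exists (fun=> 0), 0; split; first exact: aip0.
  by rewrite big1 ?addr0 // => e _; rewrite scale0r.
- exists (fun e => k * c e + c' e), (k *: g + g'); split; first exact: aip_lin.
  rewrite scalerDr addrACA; congr (_ + _).
  rewrite scaler_sumr -big_split; apply: eq_bigr => e _.
  by rewrite /= [k *: _]scalerA scalerDl.
have [q0|q1] := posnP (plen q); last first.
  exists (fun=> 0), (path_elt K q); split; first exact: aip_path.
  by rewrite big1 ?add0r // => e _; rewrite scale0r.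
exists (fun e => (e == pstart q)%:R), 0; split; first exact: aip0.
rewrite addr0 (bigD1 (pstart q)) //= eqxx scale1r big1 ?addr0 => [|e /negPf->].
  by congr path_elt; apply: qpath_eq => //; apply: size0nil.
by rewrite scale0r.
Qed.

Lemma vertex_act U e f (z : U) : pc (vertex_path f) *: z = z ->
  pc (vertex_path e) *: z = if f == e then z else 0.
Proof.
move=> <-; rewrite scalerA -quot_classM; case: eqP => [<-|ne].
  by rewrite (@path_eltS K _ _ _ (vertex_path f)) //; apply/pcompP.
by rewrite path_elt0 ?quot_class0 ?scale0r.
Qed.

(** Modulo the next layer only the component of [a] at the idempotent [e] acts, and it acts as a
    scalar. *)
Lemma act_vertex_elt U j e (z : U) (a : Lam) :
  pc (vertex_path e) *: z = z -> path_layer j z ->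
  exists c y, path_layer j.+1 y /\ a *: z = smul c z + y.
Proof.
move=> Ez Hz; have [f <-] := quot_class_surj a.
have [c [g [Hg ->]]] := vertex_decomposition f.
exists (c e), (quot_class I g *: z); split.
  by rewrite -addn1; exact: path_layer_aip.
rewrite quot_classD scalerDl; congr (_ + _).
rewrite [quot_class _ _](raddf_sum (quot_proj I)) scaler_suml (bigD1 e) //=.
rewrite big1 ?addr0 => [|e' ne]; rewrite -/(quot_class I _) quot_classZ (vertex_act _ Ez).
  by rewrite eqxx.
by rewrite eq_sym (negPf ne) smulr0.
Qed.

Lemma cyclic_submodule U (z : U) : submodule [set a *: z | a in [set: Lam]].
Proof.
split=> [|a x y [b _ <-] [c _ <-]]; first by exists 0; rewrite ?scale0r.
by exists (a * b + c) => //; rewrite scalerDl scalerA.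
Qed.

(** Radical layers are at most one-dimensional: each vertex component of [z] and [b] generate
    comparable cyclic submodules, so one is a scalar multiple of the other modulo the next layer. If
    [b] is the multiple, the scalar is invertible because [b] is outside that layer. *)
Lemma path_layer_simple U j e (b z : U) : uniserial U ->
  pc (vertex_path e) *: b = b -> path_layer j b -> ~ path_layer j.+1 b ->
  path_layer j z -> exists c, path_layer j.+1 (z - smul c b).
Proof.
move=> [_ chainU] Eb Hb Nb Hz; rewrite [z]sum_vertices.
apply: (big_ind (fun z => exists c, path_layer j.+1 (z - smul c b))) => [|x y [c Hc] [d Hd]|f _].
- by exists 0; rewrite smul0 subr0; exact: path_layer0.
- by exists (c + d); rewrite smulDl opprD addrACA; exact: path_layerD.
set y := _ *: z; have Ey : pc (vertex_path f) *: y = y.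
  by rewrite /y scalerA -quot_classM (@path_eltS K _ _ _ (vertex_path f)) //; apply/pcompP.
have Hy : path_layer j y by have := path_layer_act (vertex_path f) Hz; rewrite addn0.
case: (chainU _ _ (cyclic_submodule y) (cyclic_submodule b)) => sub.
  have [a _ <-] : [set a *: b | a in [set: Lam]] y by apply: sub; exists 1; rewrite ?scale1r.
  have [c [w [Hw ->]]] := act_vertex_elt a Eb Hb.
  by exists c; rewrite addrC addKr.
have [a _ Ea] : [set a *: y | a in [set: Lam]] b by apply: sub; exists 1; rewrite ?scale1r.
have [c [w [Hw Ew]]] := act_vertex_elt a Ey Hy.
have nz : c != 0.
  by apply: contra_notN Nb => /eqP c0; rewrite -Ea Ew c0 smul0 add0r.
exists c^-1; rewrite -Ea Ew smulDr smulA mulVf // smul1 opprD addNKr -smulN.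
exact: path_layerZ.
Qed.

Hypothesis HI : admissible I.

(** A form of Nakayama's lemma: modulo [N], [z] agrees with the image of [z] under every power of
    [f], and a high power lies in [I]. *)
Lemma nilpotent_act U (N : set U) f (z : U) : submodule N -> arrow_ideal_power 1 f ->
  N (z - quot_class I f *: z) -> N z.
Proof.
move=> HN Hf Nz; have [_ [n _ In]] := HI.
have Hn m : arrow_ideal_power m (f ^+ m) /\ N (z - quot_class I (f ^+ m) *: z).
  elim: m => [|m [IH1 IH2]].
    rewrite expr0 quot_class1 scale1r subrr; split; last by case: HN.
    by apply/aip_mcoeff.
  split; first by rewrite exprSr -addn1; exact: aipM.
  have -> : z - quot_class I (f ^+ m.+1) *: z = (z - quot_class I (f ^+ m) *: z) +
      quot_class I (f ^+ m) *: (z - quot_class I f *: z).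
    by rewrite scalerBr scalerA -quot_classM -exprSr addrA subrK.
  by apply: (submoduleD HN) => //; exact: (submoduleZ HN).
have [/In If] := Hn n.
rewrite (_ : quot_class I _ = 0) ?scale0r ?subr0 // -quot_class0.
by apply/quot_projP; rewrite subr0.
Qed.

(** The arrow ideal kills simple modules. Otherwise [N] and the image of [z] would generate [N'], so
    [z] would satisfy the hypothesis of [nilpotent_act] and lie in [N]. *)
Lemma maximal_in_act U (N N' : set U) f (z : U) : submodule N -> submodule N' ->
  maximal_in N N' -> N' z -> arrow_ideal_power 1 f -> N (quot_class I f *: z).
Proof.
move=> HN HN' [[NN' _] maxN] Nz Hf; set y := _ *: z.
pose L : set U := [set w | exists2 v, N v & exists a : Lam, w = v + a *: y].
have HL : submodule L.
  split=> [|a w w' [v Nv [b ->]] [v' Nv' [b' ->]]].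
    by exists 0; [case: HN|exists 0; rewrite scale0r addr0].
  exists (a *: v + v'); first by case: HN => _; apply.
  by exists (a * b + b'); rewrite scalerDr scalerDl scalerA addrACA.
have Ly : L y by exists 0; [case: HN|exists 1; rewrite scale1r add0r].
have NL : N `<=` L by move=> v Nv; exists v => //; exists 0; rewrite scale0r addr0.
have LN' : L `<=` N'.
  move=> w [v /NN' Nv [a ->]]; apply: (submoduleD HN') => //.
  exact: (submoduleZ HN' _ (submoduleZ HN' _ Nz)).
case: (maxN L HL NL LN') => EL; first by rewrite -EL.
have : L z by rewrite EL.
case=> v Nv [a Ez]; apply: (submoduleZ HN).
have [g Eg] := quot_class_surj a.
apply: (nilpotent_act (f := g * f)) => //.
  by rewrite -[1%N]add0n; apply: aipM.
by rewrite quot_classM Eg -scalerA -/y {1}Ez addrK.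
Qed.

(** By [maximal_in_act] on the regular module, paths of positive length lie in every maximal left
    ideal. *)
Lemma path_layer_rad U (z : U) : path_layer 1 z -> radical_submodule z.
Proof.
elim=> [|x y _ [s [Hs ->]] _ [t [Ht ->]]|c x _ [s [Hs ->]]|q t q1].
- by exists [::]; rewrite big_nil.
- exists (s ++ t); rewrite big_cat; split=> // u.
  by rewrite mem_cat => /orP[/Hs|/Ht].
- exists [seq (u.1, smul c u.2) | u <- s]; split; first by move=> _ /mapP[u /Hs Hu ->].
  by rewrite smul_sum big_map; apply: eq_bigr => u _; rewrite smul_comm.
exists [:: (pc q, t)]; rewrite big_seq1; split=> // u.
rewrite inE => /eqP -> /= M HM maxM.
rewrite -[pc q]mulr1; apply: (maximal_in_act HM _ maxM) => //; exact: aip_path.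
Qed.

Lemma composition_arrow_act U (M : nat -> set U) n s (z : U) :
  (forall i, (i <= n)%N -> submodule (M i)) ->
  (forall i, (i < n)%N -> maximal_in (M i) (M i.+1)) -> M n = setT ->
  (size s <= n)%N -> M (n - size s)%N (arrow_act s z).
Proof.
move=> HM maxM MT; elim/last_ind: s => [|s a IHs]; first by rewrite subn0 MT.
rewrite size_rcons /arrow_act foldl_rcons => sn; have := IHs (ltnW sn).
have le : (n - (size s).+1 < n)%N by rewrite ltn_subrL (leq_ltn_trans _ sn).
have E : (n - (size s).+1).+1 = (n - size s)%N by rewrite -subSn // subSS.
rewrite -E => H; apply: (maximal_in_act _ _ (maxM _ le)) => //.
- by apply: HM; exact: ltnW.
- exact: HM.
exact: aip_path.
Qed.

Lemma top_spine U p (x : U) : uniserial_with_mast p U -> top_element x -> spine p x.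
Proof.
move=> [uniU [M [M0 MT HM maxM]] [y py]] [nrx [e Ex]].
have nx : ~ path_layer 1 x by move/path_layer_rad.
(* Each arrow descends one step of the composition series, so the first [(plen p).+1] arrows of a
   longer path already give 0. *)
have L0 (z : U) : path_layer (plen p).+1 z -> z = 0.
  elim=> // [u v _ -> _ ->|c u _ ->|q t le]; rewrite ?addr0 ?smulr0 //.
  rewrite path_class_act -(cat_take_drop (plen p).+1 (parrows q)).
  rewrite /arrow_act foldl_cat; set w := foldl _ _ (take _ _).
  suff -> : w = 0 by elim: (drop _ _) => //= a s; rewrite scaler0.
  have := composition_arrow_act (s := take (plen p).+1 (parrows q))
    (pc (vertex_path (pstart q)) *: t) HM maxM MT.
  by rewrite size_takel // leqnn subnn M0 => /(_ isT).
have all0 (z : U) : path_layer 0 z.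
  rewrite [z]sum_vertices; apply: big_ind => [||f _].
  - exact: path_layer0.
  - exact: path_layerD.
  exact: path_layerP.
(* Modulo layer 1, [y] is a multiple of [x], and [p] kills layer 1; so [p] cannot kill [x] without
   killing [y]. *)
have px : pc p *: x <> 0.
  move=> px; apply: py; have [c Hc] := path_layer_simple uniU (esym Ex) (all0 x) nx (all0 y).
  have -> : y = smul c x + (y - smul c x) by rewrite addrC subrK.
  rewrite scalerDr smul_comm px smulr0 add0r; apply: L0.
  by rewrite -add1n; exact: path_layer_act.
have es : e = pstart p.
  apply/eqP/negPn/negP => /eqP ne; apply: px.
  by rewrite Ex scalerA -quot_classM path_elt0 ?quot_class0 ?scale0r.
rewrite {}es in Ex; pose b := spine_elt p x.
have bl : b (plen p) <> 0 by rewrite /b /spine_elt seg_full.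
(* In layer [j.+1], [b j] would be killed by the rest of [p], which sends it to the nonzero
   [b (plen p)]. *)
have bj j : (j <= plen p)%N -> path_layer j (b j) /\ ~ path_layer j.+1 (b j).
  move=> jl; split; first by apply: path_layerP; rewrite plen_seg // subn0.
  move=> /(path_layer_act (seg p j (plen p))); rewrite plen_seg // addSn subnKC //.
  by rewrite seg_spine_elt // => /L0.
(* Downward induction on [j]: one basis vector accounts for each one-dimensional layer quotient. *)
have span j (z : U) : (j <= (plen p).+1)%N -> path_layer j z ->
    spanned p x (fun i => (j <= i)%N) z.
  move=> jl; rewrite -(subKn jl); elim: (_ - j)%N (leq_subr j (plen p).+1) z => {j jl}[|j IHj] jl z.
    by rewrite subn0 => /L0 ->; exact: spanned0.
  have kl : ((plen p).+1 - j.+1 <= plen p)%N by rewrite subSS leq_subr.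
  have kS : ((plen p).+1 - j.+1).+1 = ((plen p).+1 - j)%N by rewrite subSS subSn.
  have [Hb Nb] := bj _ kl; move=> Hz.
  have Eb : pc (vertex_path (vert p ((plen p).+1 - j.+1))) *:
      b ((plen p).+1 - j.+1)%N = b ((plen p).+1 - j.+1)%N.
    by rewrite vertex_spine_elt eqxx.
  have [c] := path_layer_simple uniU Eb Hb Nb Hz; rewrite kS => /(IHj (ltnW jl)) Hc.
  have -> : z = smul c (b ((plen p).+1 - j.+1)%N) + (z - smul c (b ((plen p).+1 - j.+1)%N)).
    by rewrite addrC subrK.
  apply: spannedD; first by apply: spannedZ; apply: spanned_elt.
  by apply: spannedW Hc => i _; apply: leq_trans; rewrite -kS.
split=> //.
- by move=> z; have [c _ ->] := span 0 z (leq0n _) (all0 z); exists c.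
move=> a j jl; apply: (span j.+1) => //.
by rewrite -addn1; apply: (path_layer_act (arrow_path a)); case: (bj j jl).
Qed.

End TopElements.

(** ** Consequences of condition (N) *)

Section Slack.
Variables (K : fieldType) (G : quiver) (I : ideal (path_algebra K G)).
Local Notation Lam := (quot_algebra I).
Local Notation pc := (path_class I).
Implicit Types (U W : lmodType Lam).

Lemma right_subpath_seg (p u : qpath G) : u \in right_subpaths p ->
  (plen u <= plen p)%N /\ u = seg p 0 (plen u).
Proof.
move=> /right_subpathP[u' /pcompP[_ s a]].
have le : (plen u <= plen p)%N by rewrite /plen a size_cat leq_addr.
split=> //; apply: qpath_eq; first by rewrite pstart_seg vert0 s.
by rewrite parrows_seg0 a take_size_cat.
Qed.

Lemma seg_right_subpath (p : qpath G) i : (i <= plen p)%N -> seg p 0 i \in right_subpaths p.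
Proof.
move=> il; apply/right_subpathP; exists (seg p i (plen p)); apply/pcompP.
split; rewrite ?pend_seg ?pstart_seg ?vert0 //.
by rewrite -[in LHS](seg_full p) !parrows_seg !subn0 drop0 (take_split _ il).
Qed.

Section OneDetour.
Variables (p : qpath G) (HN : condition_N I) (U : lmodType Lam) (x : U).
Hypothesis Hx : spine p x.
Local Notation P := (parrows p).
Local Notation b := (spine_elt p x).
Local Notation sp := (spanned p x).

Lemma condition_N_seg (a : arrow G) i j : (i < j)%N -> (j <= plen p)%N ->
  vert p i = src a -> vert p j = tgt a -> nth a P i = a \/ nth a P j.-1 = a.
Proof.
move=> ij jl Ei Ej.
have [W [y Hy]] := spine_seg Hx (ltnW ij) jl.
have mast : is_mast I (seg p i j) by exists W; exact: spine_uniserial Hy.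
have sz : plen (seg p i j) = (j - i)%N by rewrite plen_seg.
have nthP k : (k < j - i)%N -> nth a (parrows (seg p i j)) k = nth a P (i + k).
  by move=> lt; rewrite parrows_seg nth_take // nth_drop.
have gt0 : (0 < plen (seg p i j))%N by rewrite sz subn_gt0.
have nz : monalg.mcoeff (seg p i j) (path_elt K (seg p i j)) != 0.
  by rewrite mcoeff_path_elt eqxx oner_eq0.
have [c [E|E]] := HN (alpha := a) (p := seg p i j) Ei (etrans (pend_seg p (ltnW ij)) Ej) mast gt0.
  rewrite E in nz; have [r /pcompP[_ _ Er]] := mcoeff_mulr nz.
  by left; have := nthP 0; rewrite addn0 subn_gt0 Er => <-.
rewrite E in nz; have [r /pcompP[_ _ Er]] := mcoeff_mull nz; right.
have szr : (plen r).+1 = (j - i)%N by rewrite -sz {2}/plen Er size_cat addn1.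
have := nthP (plen r); rewrite -szr Er nth_cat ltnn subnn => /(_ (ltnSn _)) Ea.
by rewrite -(subnKC (ltnW ij)) -szr addnS -[RHS]/(nth a (parrows (arrow_path a)) 0) Ea.
Qed.

(** If [a] leaves position [j] along [p], the image is the next basis element. Otherwise a segment
    from [j] cannot start with [a], so by condition (N) every segment from [j] parallel to [a] ends
    with it. *)
Lemma arrow_spine_elt (a : arrow G) j : (j <= plen p)%N ->
  sp (fun i => (j < i)%N /\ nth a P i.-1 = a) (pc (arrow_path a) *: b j).
Proof.
move=> jl; have [Ej|nj] := eqVneq (vert p j) (src a); last first.
  rewrite scalerA -quot_classM path_elt0 ?quot_class0 ?scale0r; first exact: spanned0.
  by rewrite pend_seg //; exact/eqP.
have [/andP[lt /eqP Ea]|nEa] := boolP ((j < plen p)%N && (nth a P j == a)).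
  rewrite -[in X in pc (arrow_path X)]Ea -(seg_arrow a lt) seg_spine_elt //.
  by apply: spanned_elt.
have : sp (fun i => (j < i)%N /\ vert p i = tgt a) (pc (arrow_path a) *: b j).
  have -> : pc (arrow_path a) *: b j = pc (vertex_path (tgt a)) *: (pc (arrow_path a) *: b j).
    rewrite scalerA -quot_classM (@path_eltS K _ _ _ (arrow_path a)) //; apply/pcompP.
    by split.
  by apply: spanned_vertex; case: Hx => _ _ /(_ a j jl).
apply: spannedW => i il [ji Ei]; split=> //.
have [Ea|//] := condition_N_seg ji il Ej Ei.
by rewrite (leq_trans ji il) Ea eqxx in nEa.
Qed.

(* The arrows of [s] can be read off [p] after position [j], in this order, the
   last of them being the [i]-th arrow of [p]; [es] lists the end positions. *)
Definition reads (a0 : arrow G) j (s : seq (arrow G)) i : Prop :=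
  exists es, [/\ path ltn j es, [seq nth a0 P e.-1 | e <- es] = s & last j es = i].

Lemma arrow_act_reads a0 j s : (j <= plen p)%N ->
  sp (reads a0 j s) (arrow_act s (b j)).
Proof.
move=> jl; elim/last_ind: s => [|s a IHs].
  by apply: spanned_elt => //; exists [::].
rewrite /arrow_act foldl_rcons; apply: spanned_scale IHs => i il [es [pes Es les]].
apply: spannedW (arrow_spine_elt a il) => h hl [ih Eh].
exists (rcons es h); split; rewrite ?last_rcons //; first by rewrite rcons_path pes les.
rewrite map_rcons Es; congr rcons; rewrite -Eh.
by apply: set_nth_default; rewrite prednK // (leq_ltn_trans _ ih).
Qed.

(** Omitting the end positions that read [t] leaves an increasing list. It is applied to targets of
    a detour [(a, u)]: they begin with [u] and end with [a]. *)
Lemma reads_skip a0 j s t a i :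
  reads a0 j (rcons (s ++ t) a) i -> reads a0 j (rcons s a) i.
Proof.
move=> [es [pes Es les]]; case/lastP: es => [|es h] in pes Es les *.
  by move/(congr1 size): Es; rewrite size_rcons.
rewrite last_rcons in les; rewrite map_rcons in Es; have [Es1 Ea] := rcons_inj Es.
exists (rcons (take (size s) es) h); split; rewrite ?last_rcons //; last first.
  by rewrite map_rcons map_take Es1 take_size_cat // Ea.
apply: subseq_path pes; first exact: ltn_trans.
by rewrite -!cats1 cat_subseq // take_subseq.
Qed.

End OneDetour.
End Slack.

(** * Detour relations and their coordinates *)

Section DetourRelations.
Variables (K : fieldType) (G : quiver) (I : ideal (path_algebra K G)) (p : qpath G).
Local Notation Lam := (quot_algebra I).
Local Notation pc := (path_class I).
Implicit Types (U W : lmodType Lam) (k : detour_index p -> K) (t : detour_index p).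

(** A right subpath is determined by its length, so the targets of one detour correspond to distinct
    basis positions. *)
Definition dx_pos t : nat := plen (dx_target t).

Definition in_detour alpha u : pred (detour_index p) :=
  fun t => (dx_arrow t == alpha) && (dx_sub t == u).

Definition detour_relations U (x : U) k : Prop :=
  forall alpha u, detour p alpha u ->
    quot_class I (path_elt K (arrow_path alpha) * path_elt K u) *: x =
    \sum_(t | in_detour alpha u t) quot_class I (k t *: path_elt K (dx_target t)) *: x.

Lemma dxP t : [/\ detour p (dx_arrow t) (dx_sub t), (plen (dx_sub t) < dx_pos t)%N,
  (dx_pos t <= plen p)%N, dx_target t = seg p 0 (dx_pos t)
  & vert p (dx_pos t) = tgt (dx_arrow t)].
Proof.
have /andP[Hd] := valP t; rewrite mem_filter => /andP[/andP[lt /eqP Et] vR].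
have [le Es] := right_subpath_seg vR; split=> //.
by rewrite -[dx_pos t]/(plen (ssval (val t).2)) -(pend_seg p (leq0n _)) -Es.
Qed.

Lemma dx_inj t t' : dx_arrow t = dx_arrow t' -> dx_sub t = dx_sub t' ->
  dx_pos t = dx_pos t' -> t = t'.
Proof.
move=> Ea Es Ep; apply: val_inj.
have Et : dx_target t = dx_target t'.
  by have [_ _ _ -> _] := dxP t; have [_ _ _ -> _] := dxP t'; rewrite Ep.
move: Ea Es Et; rewrite /dx_arrow /dx_sub /dx_target.
case: (val t) => -[a s] v; case: (val t') => -[a' s'] v' /= -> Es Ev.
by congr (_, _, _); exact: val_inj.
Qed.

(** The last clause rephrases that the path extending [u] by [alpha] is not a right subpath of
    [p]. *)
Lemma detourP alpha u : detour p alpha u -> exists2 au,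
  pcomp (arrow_path alpha) u = Some au & [/\ parrows au = rcons (parrows u) alpha,
   (plen u <= plen p)%N, u = seg p 0 (plen u), vert p (plen u) = src alpha
   & (plen u < plen p)%N -> nth alpha (parrows p) (plen u) <> alpha].
Proof.
case/and3P => uR + _; case E: (pcomp _ _) => [au|] //= auR.
have [ul Eu] := right_subpath_seg uR.
have [Ee Es Ea] := (pcompP _ _ _).1 E; exists au => //.
rewrite cats1 in Ea; split=> //; first by rewrite -(pend_seg p (leq0n _)) -Eu.
move=> lt En; move/negP: auR; apply.
rewrite (_ : au = seg p 0 (plen u).+1); first exact: seg_right_subpath.
apply: qpath_eq; first by rewrite pstart_seg vert0 Es Eu pstart_seg vert0.
by rewrite Ea parrows_seg0 (take_nth alpha) // En {1}Eu parrows_seg0.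
Qed.

Lemma detour_relationsE U (x : U) k : detour_relations x k <->
  forall alpha u au, detour p alpha u -> pcomp (arrow_path alpha) u = Some au ->
    pc au *: x = \sum_(t | in_detour alpha u t) smul (k t) (spine_elt p x (dx_pos t)).
Proof.
have ER alpha u : \sum_(t | in_detour alpha u t)
      quot_class I (k t *: path_elt K (dx_target t)) *: x =
    \sum_(t | in_detour alpha u t) smul (k t) (spine_elt p x (dx_pos t)).
  apply: eq_bigr => t _; rewrite quot_classZ /spine_elt /path_class.
  by have [_ _ _ <- _] := dxP t.
split=> H alpha u.
  by move=> au Hd Eau; rewrite -ER -H // (path_eltS K Eau).
by move=> Hd; have [au Eau _] := detourP Hd; rewrite ER -(H _ _ _ Hd Eau) (path_eltS K Eau).
Qed.

Hypothesis HN : condition_N I.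

Lemma sum_comb (U : lmodType Lam) (x : U) (Q : pred (detour_index p)) k :
  \sum_(t | Q t) smul (k t) (spine_elt p x (dx_pos t)) =
  comb p x (fun i => \sum_(t | Q t && (dx_pos t == i)) k t).
Proof.
rewrite (partition_big (fun t => inord (dx_pos t) : 'I_(plen p).+1) xpredT) //=.
apply: eq_bigr => i _; rewrite smul_suml.
have Ei t : (inord (dx_pos t) == i :> 'I_(plen p).+1) = (dx_pos t == i).
  by rewrite -val_eqE /= inordK // ltnS; have [] := dxP t.
by apply: eq_big => [t|t /andP[_]]; rewrite Ei // => /eqP->.
Qed.

(** The whole path [p] kills every basis element other than the first. *)
Lemma mast_comb_neq0 (U : lmodType Lam) (x : U) c : spine p x ->
  pc p *: comb p x c <> 0 -> c 0%N != 0.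
Proof.
move=> Hx; apply: contra_notN => /eqP c0.
have [//|z Hz] := seg_comb Hx (leq0n (plen p)) (leqnn _) (c := c).
rewrite seg_full c0 smul0 add0r => ->; apply: spanned_empty Hz => i il.
by rewrite ltnNge il.
Qed.

(* Expand [y] in the basis of [x]: the terms other than the leading one only
   contribute, on both sides of the relation, to readable positions. *)
Lemma distinct_coordinates_reads (U : lmodType Lam) (x y : U) k k' r (a0 : arrow G) :
  spine p x -> pc p *: y <> 0 -> detour_relations x k -> detour_relations y k' ->
  k r <> k' r ->
  exists2 j, (0 < j)%N & reads p a0 j (rcons (parrows (dx_sub r)) (dx_arrow r)) (dx_pos r).
Proof.
move=> Hx py /detour_relationsE Rx /detour_relationsE Ry nkr.
have [Hd ltr ler _ _] := dxP r.
set alpha := dx_arrow r in Hd *; set u := dx_sub r in Hd ltr *.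
have [au Eau [Ea ul Eu Eend nthu]] := detourP Hd.
have [c Ec] : exists c, y = comb p x c by case: Hx.
pose s := rcons (parrows u) alpha.
pose S i := exists2 j, (0 < j)%N & reads p a0 j s i.
(* Apart from the leading term of [y], the path [q] only produces positions in [S]. *)
have rest q : (0 < plen q)%N -> (forall i j, reads p a0 j (parrows q) i -> reads p a0 j s i) ->
    exists2 z, spanned p x S z & pc q *: y = smul (c 0%N) (pc q *: x) + z.
  move=> q0 qs; rewrite Ec /comb big_ord_recl scalerDr smul_comm (spine0 Hx).
  eexists; last by []; rewrite scaler_sumr; apply: spanned_sum => i _.
  rewrite smul_comm arrow_act_path //; apply: spannedZ.
  have il : (bump 0 i <= plen p)%N by rewrite /bump add1n.
  apply: spannedW (arrow_act_reads HN Hx a0 (parrows q) il) => h _ /qs.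
  by exists (bump 0 i).
have c0 : c 0%N != 0 by apply: (mast_comb_neq0 Hx); rewrite -Ec.
have Sr : S (dx_pos r).
  apply: contrapT => nS.
  have [z Hz Ez] : exists2 z, spanned p x S z & pc au *: y = smul (c 0%N) (pc au *: x) + z.
    by apply: rest; rewrite ?/plen Ea ?size_rcons.
  (* The same for the targets on the right-hand side; other indices [t] get the default 0, as the
     choice below needs a total function. *)
  have ex_rest t : exists w, spanned p x S w /\ (in_detour alpha u t ->
      spine_elt p y (dx_pos t) = smul (c 0%N) (spine_elt p x (dx_pos t)) + w).
    have [/andP[/eqP Eat /eqP Eut]|nin] := boolP (in_detour alpha u t); last first.
      by exists 0; split=> //; exact: spanned0.
    have [_ ltt let_ _ Et] := dxP t; rewrite Eut Eat in ltt Et.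
    (* Condition (N) on the segment from the end of [u] to that of the target: it cannot start with
       [alpha], so it ends with it. *)
    have [/(nthu (leq_trans ltt let_)) []|En] := condition_N_seg HN Hx ltt let_ Eend Et.
    have n0 : (0 < dx_pos t)%N by exact: leq_ltn_trans ltt.
    have [||w Hw Ew] := rest (seg p 0 (dx_pos t)); first by rewrite plen_seg // subn0.
      move=> i j; rewrite parrows_seg0.
      have -> : take (dx_pos t) (parrows p) = rcons (parrows u ++
          take ((dx_pos t).-1 - plen u) (drop (plen u) (parrows p))) alpha.
        rewrite -[in LHS](prednK n0) (take_nth alpha) ?prednK // En; congr rcons.
        have -> : parrows u = take (plen u) (parrows p) by rewrite {1}Eu parrows_seg0.
        rewrite -take_split //.
        by rewrite -ltnS prednK.
      exact: reads_skip.
    by exists w.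
  have [zt Hzt] := choice ex_rest.
  pose d t := c 0%N * (k' t - k t).
  (* Subtract [c 0] times the relation at [x] from the relation at [y]. *)
  have Hsum : \sum_(t | in_detour alpha u t) smul (d t) (spine_elt p x (dx_pos t)) =
      z + smul (-1) (\sum_(t | in_detour alpha u t) smul (k' t) (zt t)).
    have -> : z = pc au *: y - smul (c 0%N) (pc au *: x) by rewrite Ez addrC addKr.
    rewrite (Rx _ _ _ Hd Eau) (Ry _ _ _ Hd Eau) !smul_sum -!sumrN -!big_split /=.
    apply: eq_bigr => t Ht; have [_ /(_ Ht) ->] := Hzt t.
    rewrite /d mulrBr smulDl smulDr !smulA mulN1r !smulN [k' t * _]mulrC.
    by rewrite [RHS]addrAC addrK.
  have : spanned p x S (\sum_(t | in_detour alpha u t) smul (d t) (spine_elt p x (dx_pos t))).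
    rewrite Hsum; apply: spannedD => //; apply: spannedZ; apply: spanned_sum => t _.
    by apply: spannedZ; case: (Hzt t).
  rewrite sum_comb => /(spanned_comb Hx)/(_ ler nS).
  (* Only [r] contributes at position [dx_pos r], so its coefficient, a nonzero multiple of
     [k' r - k r], would have to vanish. *)
  rewrite (big_pred1 r) => [/eqP|t].
    by rewrite mulf_eq0 (negPf c0) subr_eq0 => /eqP/esym.
  apply/andP/eqP => [[/andP[/eqP Eat /eqP Eut] /eqP Ept]|->]; first exact: dx_inj.
  by rewrite /in_detour !eqxx.
by case: Sr => j j0 Hj; exists j.
Qed.

End DetourRelations.

(** * From reading positions to a factorisation *)

Section Factorisation.
Variables (K : fieldType) (G : quiver) (p : qpath G).

(** The arrows read at the end positions cut the initial segment of [p] into pieces: [w] precedes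
    the first of them, and the cycles are the gaps between consecutive ones. *)
Lemma reads_factor (a : arrow G) (u au : qpath G) j n :
  pcomp (arrow_path a) u = Some au -> pstart u = pstart p -> (0 < j)%N -> (n <= plen p)%N ->
  reads p a j (parrows au) n ->
  exists (w : qpath G) (eps : 'I_(plen u) -> qpath G),
    [/\ w \in right_subpaths p, pend w = pstart p, (0 < plen w)%N,
        forall i, pstart (eps i) = tgt (tnth (in_tuple (parrows u)) i) /\
                  pend (eps i) = tgt (tnth (in_tuple (parrows u)) i)
      & path_elt K (seg p 0 n) = path_elt K (arrow_path a) *
          (\prod_(i <- rev (enum 'I_(plen u)))
             (path_elt K (eps i) *
              path_elt K (arrow_path (tnth (in_tuple (parrows u)) i)))) * path_elt K w].
Proof.
move=> Eau su j0 nl [es [pes Es les]].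
have [_ sau Pau] := (pcompP _ _ _).1 Eau; rewrite su in sau.
have szes : size es = (plen u).+1.
  by rewrite -(size_map (fun e => nth a (parrows p) e.-1)) Es Pau size_cat addn1.
have szau : plen au = (plen u).+1 by rewrite /plen Pau size_cat addn1.
(* The [k]-th arrow read runs from position [(pos k).-1] to [pos k]. As [pos 0 > j > 0], the piece
   before the first one has positive length. *)
pose pos := nth 0%N es.
have pos_lt k : (k < plen u)%N -> (pos k < pos k.+1)%N.
  by move=> lt; have /(pathP 0%N)/(_ k.+1) := pes; rewrite szes ltnS => /(_ lt).
have pos0 : (j < pos 0)%N by have /(pathP 0%N)/(_ 0%N) := pes; rewrite szes => /(_ isT).
have posn : pos (plen u) = n.
  by rewrite -les (last_nth 0%N) szes.
have pos_gt0 k : (k <= plen u)%N -> (0 < pos k)%N.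
  elim: k => [_|k IHk lt]; first exact: leq_ltn_trans pos0.
  exact: leq_ltn_trans (pos_lt _ lt).
have pos_le k : (k <= plen u)%N -> (pos k <= plen p)%N.
  move=> ku; rewrite -(subKn ku); elim: (_ - k)%N (leq_subr k (plen u)) => [|m IHm] mu.
    by rewrite subn0 posn.
  apply: leq_trans (IHm (ltnW mu)); apply: ltnW.
  have -> : (plen u - m)%N = (plen u - m.+1).+1 by rewrite -subSn // subSS.
  by apply: pos_lt; rewrite ltn_subrL (leq_ltn_trans _ mu).
have pos_pred k : (k <= plen u)%N -> ((pos k).-1 < plen p)%N.
  by move=> ku; rewrite prednK ?pos_le // pos_gt0.
have pos_arrow k : (k <= plen u)%N -> nth a (parrows p) (pos k).-1 = nth a (parrows au) k.
  by move=> ku; rewrite -Es (nth_map 0%N) // szes ltnS.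
have nth_u k : (k < plen u)%N -> nth a (parrows au) k = nth a (parrows u) k.
  by move=> lt; rewrite Pau nth_cat -/(plen u) lt.
pose eps k := seg p (pos k) (pos k.+1).-1.
have eps_le k : (k < plen u)%N -> (pos k <= (pos k.+1).-1)%N.
  by move=> lt; rewrite -ltnS prednK ?pos_lt // pos_gt0.
exists (seg p 0 (pos 0).-1), (fun i => eps i); split.
- by apply: seg_right_subpath; rewrite ltnW // pos_pred.
- rewrite pend_seg // (vert_src a) ?pos_pred // pos_arrow // -(vert_src a) ?szau //.
  by rewrite vert0 sau.
- by rewrite plen_seg ?(ltnW (pos_pred _ _)) // subn0 -ltnS prednK ?pos_gt0 // (leq_ltn_trans j0).
- move=> i; have lt := ltn_ord i; rewrite pstart_seg pend_seg ?eps_le //.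
  rewrite (tnth_nth a) /= -nth_u //; split.
    rewrite -[pos i in LHS](prednK (pos_gt0 _ (ltnW lt))) (vertS a) ?pos_pred ?(ltnW lt) //.
    by rewrite pos_arrow // ltnW.
  rewrite (vert_src a) ?pos_pred // pos_arrow // -(vert_src a) ?szau //.
  by rewrite (vertS a) // szau ltnW.
pose F k := path_elt K (eps k) * path_elt K (arrow_path (nth a (parrows u) k)).
have -> : \prod_(i <- rev (enum 'I_(plen u)))
    (path_elt K (eps i) * path_elt K (arrow_path (tnth (in_tuple (parrows u)) i))) =
    \prod_(k <- rev (iota 0 (plen u))) F k.
  by rewrite -val_enum_ord -map_rev big_map; apply: eq_bigr => i _; rewrite (tnth_nth a).
have step k : (k <= plen u)%N -> path_elt K (arrow_path (nth a (parrows au) k)) *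
    path_elt K (seg p 0 (pos k).-1) = path_elt K (seg p 0 (pos k)).
  move=> ku; rewrite -pos_arrow // -seg_arrow ?pos_pred // prednK ?pos_gt0 //.
  by rewrite seg_mul // leq_pred.
(* Alternately append an arrow that is read and the gap after it. *)
have main k : (k <= plen u)%N -> path_elt K (seg p 0 (pos k).-1) =
    (\prod_(i <- rev (iota 0 k)) F i) * path_elt K (seg p 0 (pos 0).-1).
  elim: k => [|k IHk] lt; first by rewrite big_nil mul1r.
  rewrite -addn1 iotaD add0n cats1 rev_rcons big_cons addn1 -mulrA -IHk ?(ltnW lt) //.
  by rewrite /F -mulrA -nth_u // step ?(ltnW lt) // seg_mul // eps_le.
rewrite -mulrA -main // -posn -step //; congr (path_elt _ (arrow_path _) * _).
by rewrite Pau nth_cat ltnn subnn.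
Qed.
End Factorisation.

(** ** Finitely many isomorphism classes *)

Section IsoClasses.
Variables (K : fieldType) (G : quiver) (I : ideal (path_algebra K G)) (p : qpath G).
Local Notation Lam := (quot_algebra I).
Local Notation pc := (path_class I).
Hypotheses (HI : admissible I) (HN : condition_N I).

Definition class_points (W : lmodType Lam) : set (detour_index p -> K) :=
  [set k | exists (U : lmodType Lam) (x : U),
     [/\ uniserial_with_mast p U, top_element x, detour_relations x k & isomorphic U W]].

(** Top elements are transported along the isomorphisms into one fixed module, where they can be
    compared. *)
Lemma class_points_common (W : lmodType Lam) k : class_points W k ->
  exists (U : lmodType Lam) (x : U), [/\ spine p x, detour_relations x k &
    forall k', class_points W k' -> exists y : U, [/\ pc p *: y <> 0,
      pc (vertex_path (pstart p)) *: y = y & detour_relations y k']].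
Proof.
move=> [U [x [uU tx Rx [f f_bij]]]]; have Hx := top_spine HI uU tx.
exists U, x; split=> // k' [U' [x' [uU' tx' Rx' [f' f'_bij]]]].
have [Ex' _ _ px'] := top_spine HI uU' tx'.
have [g fK gK] := f_bij; have Ey : f (g (f' x')) = f' x' by rewrite gK.
have f_inj := bij_inj f_bij; have f'_inj := bij_inj f'_bij.
exists (g (f' x')); split.
- move=> /(congr1 f); rewrite linearZ /= Ey -linearZ linear0 -(linear0 f') => /f'_inj.
  by move: px'; rewrite /spine_elt seg_full.
- by apply: f_inj; rewrite linearZ /= Ey -linearZ Ex'.
move=> alpha u Hd; apply: f_inj; rewrite linearZ /= Ey -linearZ Rx' // !linear_sum.
by apply: eq_bigr => t _; rewrite [LHS]linearZ [RHS]linearZ /= Ey.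
Qed.

Lemma mast_variety_classes n (M : 'I_n -> lmodType Lam) :
  (forall U : lmodType Lam, uniserial_with_mast p U -> exists i, isomorphic U (M i)) ->
  forall k : detour_index p -> K, mast_variety I k -> exists i, class_points (M i) k.
Proof.
move=> HM k [U [x [uU tx Rx]]]; have [i Ui] := HM U uU.
by exists i, U, x; split.
Qed.

(** Were the coordinate constant, equal to [c i], on each of the finitely many pieces, it would be a
    root of the product of the ['X - c i] in the coordinate ring. *)
Lemma transcendental_coordinate n (V : 'I_n -> set (detour_index p -> K)) r :
  (forall k, mast_variety I k -> exists i, V i k) ->
  transcendental (@scalar_class K G I p) (variable_class I r) ->
  exists i k k', [/\ V i k, V i k' & k r <> k' r].
Proof.
move=> HV Htr; apply: contrapT => nV.
(* An empty piece gets the arbitrary value 0. *)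
have ex_val i : exists c, forall k, V i k -> k r = c.
  have [[k Vk]|none] := pselect (exists k, V i k); last first.
    by exists 0 => k Vk; case: none; exists k.
  by exists (k r) => k' Vk'; apply: contrapT => ne; apply: nV; exists i, k', k.
have [c Hc] := choice ex_val.
pose piV := quot_proj (vanishing_ideal I p); pose q := \prod_(i < n) ('X - (c i)%:P).
have /eqP : q != 0 by apply/monic_neq0/monic_prod_XsubC.
apply; apply: Htr.
have -> : \sum_(i < size q) scalar_class I p q`_i * variable_class I r ^+ i =
    piV (\sum_(i < size q) (mpolyC _ q`_i : detour_polynomial K p) *
         (mpolyX K (mnm1 (enum_rank r)) : detour_polynomial K p) ^+ i).
  have piM a b : piV (a * b) = piV a * piV b by exact: (rmorphM (quot_proj _)).
  have piX a m : piV (a ^+ m) = piV a ^+ m by exact: (rmorphXn (quot_proj _)).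
  have piS m (F : 'I_m -> detour_polynomial K p) :
    piV (\sum_(i < m) F i) = \sum_(i < m) piV (F i) by exact: (raddf_sum (quot_proj _)).
  rewrite [RHS]piS; apply: eq_bigr => i _.
  by rewrite [RHS]piM piX.
rewrite -[RHS](raddf0 (quot_proj (vanishing_ideal I p))); apply/quot_projP; rewrite subr0.
move=> k /HV[i Vi]; pose v (j : 'I_#|{: detour_index p}|) := k (enum_val j).
have evS m (F : 'I_m -> detour_polynomial K p) :
  meval v (\sum_(i < m) F i) = \sum_(i < m) meval v (F i).
  by apply: (big_morph (meval v)) => [a b|]; [exact: mevalD|exact: meval0].
have evM (a b : detour_polynomial K p) : meval v (a * b) = meval v a * meval v b.
  exact: mevalM.
have evX (a : detour_polynomial K p) m : meval v (a ^+ m) = meval v a ^+ m.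
  by elim: m => [|m IHm]; rewrite ?exprS ?evM ?IHm //; exact: meval1.
transitivity (q.[k r]).
  rewrite [LHS]evS horner_coef; apply: eq_bigr => j _.
  by rewrite evM evX mevalC mevalXU /v enum_rankK.
rewrite /q horner_prod (bigD1 i) //= hornerXsubC (Hc i k Vi) subrr mul0r //.
Qed.

Lemma slack_points n (M : 'I_n -> lmodType Lam) r :
  (forall U : lmodType Lam, uniserial_with_mast p U -> exists i, isomorphic U (M i)) ->
  slack_variable I r -> exists (U : lmodType Lam) (x y : U) (k k' : detour_index p -> K),
    [/\ spine p x, pc p *: y <> 0, detour_relations x k, detour_relations y k'
      & k r <> k' r].
Proof.
move=> HM [_ Htr]; have [i [k [k' [Vk Vk' ne]]]] :=
  transcendental_coordinate (mast_variety_classes HM) Htr.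
have [U [x [Hx Rx Hk]]] := class_points_common Vk; have [y [py _ Ry]] := Hk _ Vk'.
by exists U, x, y, k, k'.
Qed.

Lemma slack_factorisation (r : detour_index p) : finitely_many_uniserials I p ->
  slack_variable I r ->
  exists (w : qpath G) (eps : 'I_(plen (dx_sub r)) -> qpath G),
    [/\ w \in right_subpaths p, pend w = pstart p, (0 < plen w)%N,
        forall i, pstart (eps i) = tgt (tnth (in_tuple (parrows (dx_sub r))) i) /\
                  pend (eps i) = tgt (tnth (in_tuple (parrows (dx_sub r))) i)
      & path_elt K (dx_target r) = path_elt K (arrow_path (dx_arrow r)) *
          (\prod_(i <- rev (enum 'I_(plen (dx_sub r))))
             (path_elt K (eps i) *
              path_elt K (arrow_path (tnth (in_tuple (parrows (dx_sub r))) i)))) *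
          path_elt K w].
Proof.
move=> [n [M HM]] Hr; have [U [x [y [k [k' [Hx py Rx Ry ne]]]]]] := slack_points HM Hr.
have [j j0 Hj] := distinct_coordinates_reads HN (dx_arrow r) Hx py Rx Ry ne.
have [Hd _ rl -> _] := dxP r; have [au Eau [Ea _ Eu _ _]] := detourP Hd.
apply: (reads_factor K Eau _ j0 rl); last by rewrite Ea.
by rewrite Eu pstart_seg vert0.
Qed.
End IsoClasses.

(** ** Algebraic dependence and chains of primes *)

Section DigitEval.
Variables (K : fieldType) (D : nat).

(* The polynomial in [fs] of degree < D in each variable, the coefficients being
   indexed by the exponents read as digits in base D. *)
Fixpoint digit_eval (S : comPzRingType) (iota : K -> S) (fs : seq S) (a : nat -> K) : S :=
  if fs is f :: fs' then
    \sum_(k < D) f ^+ k * digit_eval iota fs' (fun n => a (k + D * n)%N)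
  else iota (a 0%N).

Lemma digit_eval_morph (S T : comPzRingType) (iota : K -> S) (phi : {rmorphism S -> T}) fs a :
  phi (digit_eval iota fs a) = digit_eval (phi \o iota) (map phi fs) a.
Proof.
elim: fs a => //= f fs IHfs a; rewrite rmorph_sum; apply: eq_bigr => k _.
by rewrite rmorphM rmorphXn IHfs.
Qed.

Lemma eq_digit_eval (S : comPzRingType) (iota iota' : K -> S) fs a :
  iota =1 iota' -> digit_eval iota fs a = digit_eval iota' fs a.
Proof.
move=> E; elim: fs a => //= f fs IHfs a.
by apply: eq_bigr => k _; rewrite IHfs.
Qed.

Lemma digit_lt k n s : (k < D)%N -> (n < D ^ s)%N -> (k + D * n < D ^ s.+1)%N.
Proof.
move=> kD nD; rewrite expnS; apply: (@leq_trans (D * n.+1)).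
  by rewrite mulnS ltn_add2r.
by rewrite leq_mul2l nD orbT.
Qed.

Section Linear.
Variables (S : comPzRingType) (iota : {rmorphism K -> S}).

Lemma digit_eval0 fs a : (forall n, (n < D ^ size fs)%N -> a n = 0) ->
  digit_eval iota fs a = 0.
Proof.
elim: fs a => [|f fs IHfs] a a0 /=; first by rewrite a0 ?rmorph0.
apply: big1 => k _; rewrite IHfs ?mulr0 // => n lt.
by apply: a0; apply: digit_lt.
Qed.

Lemma digit_eval_sum fs (J : finType) (c : J -> K) (a : J -> nat -> K) :
  digit_eval iota fs (fun n => \sum_j c j * a j n) =
  \sum_j iota (c j) * digit_eval iota fs (a j).
Proof.
elim: fs a => [|f fs IHfs] a /=.
  by rewrite rmorph_sum; apply: eq_bigr => j _; rewrite rmorphM.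
under eq_bigr => k _ do rewrite (IHfs (fun j n => a j (k + D * n)%N)) mulr_sumr.
rewrite exchange_big; apply: eq_bigr => j _; rewrite mulr_sumr.
by apply: eq_bigr => k _; rewrite mulrCA.
Qed.

End Linear.
End DigitEval.

Section PrimeChains.
Variables (K : fieldType) (S : comPzRingType) (iota : {rmorphism K -> S}).

Lemma prime_idealP (P : set S) : prime_ideal P ->
  [/\ P 0, forall x y, P x -> P y -> P (x + y), forall a x, P x -> P (a * x),
      ~ P 1 & forall a b, P (a * b) -> P a \/ P b].
Proof.
case=> -[P0 PL] P1 PM; split=> // [x y Px Py|a x Px].
  by rewrite -[x]mul1r; exact: (PL 1).
by rewrite -[a * x]addr0; exact: (PL a).
Qed.

Lemma prime_exp (P : set S) f k : prime_ideal P -> P (f ^+ k) -> P f.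
Proof.
move=> /prime_idealP[_ _ _ P1 PM]; elim: k => [|k IHk]; first by rewrite expr0.
by rewrite exprS => /PM[].
Qed.

(* An element of [P 1] outside [P 0] is algebraically independent modulo [P 0]
   of any family that is independent modulo [P 1]. *)
Lemma prime_chain_independent n (P : nat -> set S) : prime_chain n P ->
  exists2 fs, size fs = n & forall D a, P 0%N (digit_eval D iota fs a) ->
    forall m, (m < D ^ n)%N -> a m = 0.
Proof.
elim: n P => [|n IHn] P [Pp Ps].
  (* A nonzero scalar is a unit, so it lies outside the proper ideal [P 0]. *)
  exists [::] => // D a /= P0a [|//] _; apply/eqP/negPn/negP => nz.
  have [_ _ Pm P1 _] := prime_idealP (Pp 0%N isT).
  by apply: P1; rewrite -(rmorph1 iota) -(mulVf nz) rmorphM; exact: Pm.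
have [|fs szfs indep] := IHn (fun i => P i.+1).
  by split=> i lt; [exact: Pp|exact: Ps].
have [P01 /existsNP[f /not_implyP[P1f P0f]]] := Ps 0%N isT.
have [P0_0 P0D P0m P0_1 P0M] := prime_idealP (Pp 0%N isT).
have [P1_0 P1D P1m P1_1 P1M] := prime_idealP (Pp 1%N isT).
exists (f :: fs); rewrite /= ?szfs // => D a P0a.
pose g k := digit_eval D iota fs (fun n => a (k + D * n)%N).
(* Once the coefficients of lower powers vanish, [f ^+ k] splits off and, [f] being outside the
   prime [P 0], the cofactor is in [P 0], hence in [P 1]. Its terms with a factor [f] lie in [P 1],
   so [g k] does too, and independence modulo [P 1] applies. *)
have a0 k : (k < D)%N -> forall m, (m < D ^ n)%N -> a (k + D * m)%N = 0.
  elim/ltn_ind: k => k IHk kD.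
  have g0 i : (i < k)%N -> g i = 0.
    by move=> ik; apply: digit_eval0 => m; rewrite szfs; apply: IHk => //; exact: ltn_trans kD.
  have : P 0%N (f ^+ k * \sum_(i < D - k) f ^+ i * g (k + i)%N).
    move: P0a; rewrite -(big_mkord xpredT (fun i => f ^+ i * g i)).
    rewrite (big_cat_nat (n := k)) ?(ltnW kD) //=.
    rewrite big_nat big1 => [|i /andP[_ /g0->]]; last by rewrite mulr0.
    rewrite add0r -{1}[k]add0n big_addn big_mkord mulr_sumr.
    congr (P _ _); apply: eq_bigr => i _; by rewrite mulrA -exprD addnC.
  case/P0M => [/(prime_exp (Pp 0%N isT))//|/P01].
  have -> : (D - k)%N = (D - k).-1.+1 by rewrite prednK // subn_gt0.
  rewrite big_ord_recl mul1r addn0 => P1sum; apply: indep.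
  set rest := \sum_(i < _) _ in P1sum.
  have P1rest : P 1%N (- rest).
    rewrite -mulN1r; apply: (P1m); rewrite /rest; apply: big_ind => // i _.
    by rewrite exprS -mulrA mulrC; exact: P1m.
  by have := P1D _ _ P1sum P1rest; rewrite addrK.
(* Split off the lowest digit of [m] in base [D]. *)
move=> m; rewrite expnS => mD; have D0 : (0 < D)%N by case: D mD {P0a g a0}.
rewrite (divn_eq m D) addnC mulnC; apply: a0; first by rewrite ltn_mod.
by rewrite ltn_divLR // mulnC.
Qed.

End PrimeChains.

Section AlgebraicDependence.
Variables (K : fieldType) (m : nat).

(** [msize] is one more than the degree, and 0 for the zero polynomial. *)
Definition deg_le d (f : {mpoly K[m]}) := (msize f <= d.+1)%N.

Lemma deg_leM d e f g : deg_le d f -> deg_le e g -> deg_le (d + e) (f * g).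
Proof.
rewrite /deg_le; have [->|nzf] := eqVneq f 0; first by rewrite mul0r msize0.
have [->|nzg] := eqVneq g 0; first by rewrite mulr0 msize0.
move=> fd ge; rewrite msizeM // -subn1 leq_subLR add1n.
by rewrite -[(d + e).+2]/(d.+1 + e).+1 -addnS leq_add.
Qed.

Lemma deg_leX d f k : deg_le d f -> deg_le (k * d) (f ^+ k).
Proof.
move=> fd; elim: k => [|k IHk]; first by rewrite expr0 /deg_le msize1.
by rewrite exprS mulSn; exact: deg_leM.
Qed.

Lemma deg_le_sum d (J : Type) (r : seq J) (F : J -> {mpoly K[m]}) :
  (forall j, deg_le d (F j)) -> deg_le d (\sum_(j <- r) F j).
Proof.
move=> dF; apply: (big_ind (deg_le d)) => //; first by rewrite /deg_le msize0.
move=> f g df dg; apply: (leq_trans (msizeD_le f g)).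
by rewrite geq_max; apply/andP.
Qed.

Lemma deg_le_digit_eval D d fs a : (forall f, f \in fs -> deg_le d f) ->
  deg_le (size fs * (D * d)) (digit_eval D (@mpolyC m K) fs a).
Proof.
elim: fs a => [|f fs IHfs] a dfs /=; first by rewrite /deg_le msizeC; case: eqP.
apply: deg_le_sum => k; rewrite mulSn; apply: deg_leM; last first.
  by apply: IHfs => g gfs; apply: dfs; rewrite inE gfs orbT.
apply: (leq_trans (deg_leX k (dfs f (mem_head _ _)))).
by rewrite ltnS leq_mul2r ltnW // orbT.
Qed.

Lemma card_bmultinom_le n : (#|{: 'X_{1..m < n.+1}}| <= n.+1 ^ m)%N.
Proof.
have coord (b : 'X_{1..m < n.+1}) i : (b i < n.+1)%N.
  apply: leq_ltn_trans (bmdeg b); rewrite mdegE (bigD1 i) //=; exact: leq_addr.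
pose f (b : 'X_{1..m < n.+1}) := [ffun i => Ordinal (coord b i)].
rewrite -[m in X in (_ <= X)%N]card_ord -[n.+1 in X in (_ <= X)%N]card_ord -card_ffun.
apply: (leq_card f) => b c /ffunP E; apply/val_inj/mnmP => i.
by have := congr1 val (E i); rewrite !ffunE.
Qed.

(* There are D^(m+1) monomials of degree < D in m+1 elements, which live in a
   space of dimension O(D^m). *)
Lemma mpoly_dependent (fs : seq {mpoly K[m]}) : (m < size fs)%N ->
  exists D a, (exists2 j, (j < D ^ size fs)%N & a j != 0) /\
    digit_eval D (@mpolyC m K) fs a = 0.
Proof.
move=> mfs; pose s := size fs; pose d := \max_(f <- fs) msize f.
have dfs f : f \in fs -> deg_le d f.
  by move=> ffs; apply: leqW; rewrite /d (big_rem f) //= leq_maxl.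
(* [E] bounds the degree of all combinations and [E.+1 <= D * C], so at most [(D * C) ^ m] monomials
   occur. This is below [D ^ m.+1] because [D > C ^ m]. *)
pose C := (s * d).+1; pose D := (C ^ m).+1; pose E := (s * (D * d))%N.
pose N := #|{: 'X_{1..m < E.+1}}|.
have ND : (N < D ^ s)%N.
  apply: (leq_ltn_trans (card_bmultinom_le E)).
  apply: (@leq_ltn_trans ((D * C) ^ m)).
    have EDC : (E.+1 <= D * C)%N by rewrite /E /C mulnS mulnCA -add1n leq_add2r.
    by elim: (m) => // i IHi; rewrite !expnS leq_mul.
  apply: (@leq_trans (D ^ m.+1)); last by rewrite leq_pexp2l.
  by rewrite expnMn expnSr ltn_mul2l expn_gt0 /D ltnSn.
(* Row [i] of [A] lists the coefficients of the [i]-th product of powers of [fs]; with more rows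
   than columns, some nonzero [v] kills [A] from the left. *)
pose delta (i : 'I_(D ^ s)) (n : nat) : K := (n == i :> nat)%:R.
pose A := \matrix_(i < D ^ s, j < N)
  (digit_eval D (@mpolyC m K) fs (delta i))@_(bmnm (enum_val j)).
have : kermx A != 0.
  rewrite kermx_eq0 /row_free; apply: contraL ND => /eqP <-.
  by rewrite -leqNgt; exact: rank_leq_col.
case/rowV0Pn => v /sub_kermxP vA nzv.
exists D, (fun n => \sum_i v 0 i * delta i n); split.
  have [j nzj] : exists j, v 0 j != 0.
    apply: contrapT => none; case/eqP: nzv; apply/rowP => j; rewrite mxE.
    by apply/eqP/negPn/negP => nz; apply: none; exists j.
  exists j; first exact: ltn_ord.
  rewrite (bigD1 j) //= {1}/delta eqxx mulr1 big1 ?addr0 // => i ne.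
  by rewrite /delta eq_sym val_eqE (negPf ne) mulr0.
set h := digit_eval _ _ _ _.
have hd : (msize h <= E.+1)%N by exact: deg_le_digit_eval.
apply/mpolyP => mn; rewrite mcoeff0.
have [lt|ge] := ltnP (mdeg mn) E.+1; last first.
  by apply/memN_msupp_eq0/msize_mdeg_ge/(leq_trans hd).
have := congr1 (fun B : 'rV_N => B 0 (enum_rank (BMultinom lt))) vA.
rewrite !mxE => <-; rewrite /h (digit_eval_sum D (@mpolyC m K)) raddf_sum.
by apply: eq_bigr => i _; rewrite mxE enum_rankK /= mcoeffCM.
Qed.

End AlgebraicDependence.

(** * Krull dimension of a set covered by polynomial images *)

Section KrullBound.
Variables (K : fieldType) (G : quiver) (I : ideal (path_algebra K G)) (p : qpath G).
Local Notation N := #|{: detour_index p}|.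
Local Notation A := (coordinate_ring I p).

Let proj (f : {mpoly K[N]}) : A := quot_proj (vanishing_ideal I p) f.

Let projD f g : proj (f + g) = proj f + proj g.
Proof. exact: quot_projD. Qed.
Let projM f g : proj (f * g) = proj f * proj g.
Proof. exact: (rmorphM (quot_proj (vanishing_ideal I p))). Qed.
Let proj1 : proj 1 = 1.
Proof. exact: (rmorph1 (quot_proj (vanishing_ideal I p))). Qed.
Let proj_eq0 f : (forall k, mast_variety I k -> f.@[fun i => k (enum_val i)] = 0) -> proj f = 0.
Proof.
move=> Hf; rewrite -[RHS](quot_proj0 (vanishing_ideal I p)).
by apply/quot_projP; rewrite subr0.
Qed.

Let prime_preimage (P : set A) : prime_ideal P -> prime_ideal [set f | P (proj f)].
Proof.
move=> [[P0 PL] P1 PM]; split=> [||a b] /=; last by rewrite projM; exact: PM.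
  split=> [|a x y Px Py] /=; first by rewrite proj_eq0 // => k _; rewrite meval0.
  by rewrite projD projM; exact: PL.
by rewrite proj1.
Qed.

Let prime_chain_preimage n (P : nat -> set A) : prime_chain n P ->
  prime_chain n (fun i => [set f | P i (proj f)]).
Proof.
move=> [Pp Ps]; split=> i lt; first by apply: prime_preimage; exact: Pp.
have [sub nsub] := Ps i lt; split=> [f /= /sub //|nsub'].
apply: nsub => a Pa; have [f Ef] := quot_proj_surj a.
by move: (nsub' f); rewrite /= /proj Ef; apply.
Qed.

(** If [d > m], the [d] functions independent modulo the smallest prime satisfy a relation on each
    image. The product of these relations vanishes on the variety, so one of them lies in that
    prime, against independence. *)
Lemma krull_dim_le m n (Phi : 'I_n -> N.-tuple {mpoly K[m]}) d :
  (forall k, mast_variety I k ->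
     exists i c, forall j, k (enum_val j) = (tnth (Phi i) j).@[c]) ->
  dim_V I p d -> (d <= m)%N.
Proof.
move=> HPhi [[P HP] _]; rewrite leqNgt; apply/negP => md.
have HP' := prime_chain_preimage HP.
have [fs szfs indep] := prime_chain_independent (@mpolyC N K) HP'.
(* Pulled back along [Phi i], the functions are more than [m] polynomials in [m] variables. *)
have dep i : exists Da : nat * (nat -> K), (exists2 j, (j < Da.1 ^ d)%N & Da.2 j != 0) /\
    digit_eval Da.1 (@mpolyC m K) [seq f \mPo (Phi i) | f <- fs] Da.2 = 0.
  have [|D [a]] := @mpoly_dependent K m [seq f \mPo (Phi i) | f <- fs].
    by rewrite size_map szfs.
  by rewrite size_map szfs => H; exists (D, a).
have [Da HDa] := choice dep.
pose h i := digit_eval (Da i).1 (@mpolyC N K) fs (Da i).2.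
have [P0 _ Pm P1 PM] := prime_idealP (HP'.1 0%N (leq0n _)).
have hprod : proj (\prod_(i < n) h i) = 0.
  apply: proj_eq0 => k /HPhi[i [c Ec]]; rewrite rmorph_prod (bigD1 i) //=.
  have -> : (h i).@[fun j => k (enum_val j)] = (h i \mPo Phi i).@[c].
    by rewrite comp_mpoly_meval; apply: meval_eq => j; rewrite Ec.
  have -> : h i \mPo Phi i = 0; last by rewrite meval0 mul0r.
  rewrite /h (digit_eval_morph (Da i).1 (@mpolyC N K) (comp_mpoly (Phi i))) -[RHS](HDa i).2.
  by apply: eq_digit_eval => x /=; rewrite comp_mpolyC.
have : P 0%N (proj (\prod_(i < n) h i))
  by rewrite hprod -(proj_eq0 (f := 0)) // => k _; rewrite meval0.
suff Hi (r : seq 'I_n) : P 0%N (proj (\prod_(i <- r) h i)) -> exists i, P 0%N (proj (h i)).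
  move=> /Hi[i /(indep _ _) H]; have [[j jlt /eqP]] := HDa i; case; exact: H.
elim: r => [|i r IHr]; first by rewrite big_nil => /P1.
by rewrite big_cons => /PM[|/IHr]; [exists i|].
Qed.

End KrullBound.

(** ** The top elements of one module *)

Section OrbitPolynomials.
Variables (K : fieldType) (G : quiver) (I : ideal (path_algebra K G)) (p : qpath G).
Local Notation Lam := (quot_algebra I).
Local Notation pc := (path_class I).
Local Notation l := (plen p).
Local Notation N := #|{: detour_index p}|.

Definition returns : seq nat := [seq j <- iota 1 l | vert p j == pstart p].
Local Notation m := (size returns).

Lemma mem_returns j : (j \in returns) = [&& (0 < j)%N, (j <= l)%N & vert p j == pstart p].
Proof. by rewrite mem_filter mem_iota add1n ltnS andbC andbA. Qed.

(** A variable at each return, 1 at position 0 and 0 elsewhere: [index] falls out of range exactly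
    when [j] is not a return. *)
Definition generic_coef (j : nat) : {mpoly K[m]} :=
  if insub (index j returns) is Some i then 'X_i else (j == 0%N)%:R.

(** Divide by the leading coefficient. Coefficients at other vertices vanish because the start
    idempotent fixes [y]. *)
Lemma generic_coefP (U : lmodType Lam) (x y : U) : spine p x -> pc p *: y <> 0 ->
  pc (vertex_path (pstart p)) *: y = y ->
  exists mu c, y = smul mu (comb p x (fun j => (generic_coef j).@[c])).
Proof.
move=> Hx py sy; have [c0 Ec0] : exists c, y = comb p x c by case: Hx.
have nz : c0 0%N != 0 by apply: (mast_comb_neq0 Hx); rewrite -Ec0.
exists (c0 0%N), (fun i => c0 (nth 0%N returns i) / c0 0%N).
rewrite {1}Ec0 combZ; apply: eq_bigr => j _; congr smul; rewrite /generic_coef.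
have jl : (j <= l)%N by rewrite -ltnS.
case: insubP => [i jr Ei|].
  rewrite mevalXU Ei nth_index; first by rewrite mulrC divfK.
  by rewrite -index_mem.
rewrite index_mem mem_returns jl; case: (posnP j) => [->|j0] /=.
  by rewrite rmorph1 mulr1.
move=> nstart; rewrite rmorph0 mulr0.
move: sy; rewrite Ec0 vertex_comb => /(comb_inj Hx)/(_ _ jl).
by rewrite (negPf nstart).
Qed.

(** The coordinates of a relation at [y] are those of a vector in the basis belonging to [y]. The
    matrix of that basis over the basis of [x] has determinant 1, so its inverse is the adjugate,
    with polynomial entries. *)
Lemma orbit_polynomials (U : lmodType Lam) (x : U) : spine p x ->
  exists Phi : N.-tuple {mpoly K[m]}, forall (y : U) (k : detour_index p -> K),
    pc p *: y <> 0 -> pc (vertex_path (pstart p)) *: y = y -> detour_relations y k ->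
    exists c, forall j, k (enum_val j) = (tnth Phi j).@[c].
Proof.
move=> Hx.
have coefs (qj : qpath G * nat) : exists c, pc qj.1 *: spine_elt p x qj.2 = comb p x c.
  by case: Hx.
have [g Hg] := choice coefs.
have gen_au (t : detour_index p) : exists au, pcomp (arrow_path (dx_arrow t)) (dx_sub t) = Some au.
  by have [Hd _ _ _ _] := dxP t; have [au Eau _] := detourP Hd; exists au.
have [au Hau] := choice gen_au.
(* Coordinates, over [x], of the image under [q] of the generic top element; the rows of [MM] are
   its spine. *)
pose row q : 'rV[{mpoly K[m]}]_l.+1 :=
  \row_i \sum_(j < l.+1) generic_coef j * (g (q, j : nat) i)%:MP.
pose MM := \matrix_(h < l.+1) row (seg p 0 h).
pose kappa t := row (au t) *m \adj MM.
exists [tuple kappa (enum_val j) 0 (inord (dx_pos (enum_val j))) | j < N].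
move=> y k py sy Ry; have [mu [c Ey]] := generic_coefP Hx py sy.
exists c => j; rewrite tnth_mktuple; set t := enum_val j.
have nzmu : mu != 0.
  by apply: contra_notN py => /eqP mu0; rewrite Ey mu0 smul0 scaler0.
pose y' := comb p x (fun j => (generic_coef j).@[c]).
pose ev := map_mx (meval c).
have rowE q : pc q *: y' = comb p x (fun i => ev _ _ (row q) 0 (inord i)).
  rewrite /y' /comb scaler_sumr.
  under eq_bigr => i _ do rewrite smul_comm (Hg (q, i : nat)) combZ.
  rewrite exchange_big; apply: eq_bigr => i _; rewrite -smul_suml; congr smul.
  rewrite !mxE raddf_sum inord_val; apply: eq_bigr => h _ /=.
  by rewrite mevalM mevalC.
have [Hd _ tl _ _] := dxP t.
(* The relations are linear in the top element, so rescaling [y] to [y'] keeps the same [k]. *)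
have relE : pc (au t) *: y' =
    \sum_(t' | in_detour (dx_arrow t) (dx_sub t) t') smul (k t') (spine_elt p y' (dx_pos t')).
  have Ey' : y' = smul mu^-1 y by rewrite Ey smulA mulVf // smul1.
  rewrite Ey' smul_comm ((detour_relationsE _ _).1 Ry _ _ _ Hd (Hau t)) smul_sum.
  by apply: eq_bigr => t' _; rewrite /spine_elt smul_comm !smulA mulrC.
pose kap : 'rV[K]_l.+1 := \row_h \sum_(t' | in_detour (dx_arrow t) (dx_sub t) t' &&
  (dx_pos t' == h)) k t'.
have rowk : ev _ _ (row (au t)) = kap *m ev _ _ MM.
  apply/rowP => i; have il : (i <= l)%N by rewrite -ltnS.
  move: relE; rewrite sum_comb rowE [in RHS]/comb.
  under [RHS]eq_bigr => h _ do rewrite /spine_elt rowE combZ.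
  have -> : \sum_(h < l.+1) comb p x (fun i => (\sum_(t' | in_detour (dx_arrow t) (dx_sub t) t' &&
      (dx_pos t' == h)) k t') * ev _ _ (row (seg p 0 h)) 0 (inord i)) =
    comb p x (fun i => \sum_(h < l.+1) kap 0 h * ev _ _ (row (seg p 0 h)) 0 (inord i)).
    rewrite exchange_big; apply: eq_bigr => h _; rewrite smul_suml.
    by apply: eq_bigr => h' _; congr (smul (_ * _) _); rewrite mxE.
  move/(comb_inj Hx)/(_ _ il); rewrite inord_val => ->; rewrite mxE.
  by apply: eq_bigr => h _; rewrite !mxE.
(* By [seg_comb] the row at [h] has leading position [h], with coefficient [generic_coef 0 = 1]. *)
have MM_tri (h i : 'I_l.+1) : (i <= h)%N -> ev _ _ MM h i = (i == h)%:R.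
  move=> ih; have hl : (h <= l)%N by rewrite -ltnS.
  have il : (i <= l)%N by rewrite -ltnS.
  have [|z [d d0 ->]] := seg_comb Hx (leq0n h) hl (c := fun j => (generic_coef j).@[c]).
    by [].
  rewrite -/y' rowE.
  have -> : (generic_coef 0).@[c] = 1.
    rewrite /generic_coef insubF ?rmorph1 //.
    by rewrite index_mem mem_returns.
  rewrite smul1 (comb_delta x hl) combD => /(comb_inj Hx)/(_ _ il).
  rewrite inord_val d0 ?addr0; last by apply/negP; rewrite -leqNgt.
  by move=> <-; rewrite !mxE.
have detMM : \det (ev _ _ MM) = 1.
  (* [det_trig] concerns lower triangular matrices, while this one is upper triangular. *)
  rewrite -det_tr det_trig; last first.
    apply/is_trig_mxP => i h ih; rewrite mxE MM_tri ?(ltnW ih) //.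
    by rewrite -val_eqE /= (ltn_eqF ih).
  by rewrite big1 // => i _; rewrite mxE MM_tri ?eqxx.
have : ev _ _ (kappa t) = kap.
  transitivity (ev _ _ (row (au t)) *m \adj (ev _ _ MM)).
    by rewrite /ev map_mxM map_mx_adj.
  by rewrite rowk -mulmxA mul_mx_adj detMM mulmx1.
move/(congr1 (fun B : 'rV_l.+1 => B 0 (inord (dx_pos t)))); rewrite !mxE => ->.
rewrite inordK ?ltnS // (big_pred1 t) // => t'.
apply/andP/eqP => [[/andP[/eqP Eat /eqP Eut] /eqP Ept]|->]; first exact: dx_inj.
by rewrite /in_detour !eqxx.
Qed.

Hypothesis HI : admissible I.

(** The successor accounts for the start itself. *)
Lemma size_returns : (size returns).+1 = count_mem (pstart p) (pverts p).
Proof.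
rewrite /= eqxx add1n; congr _.+1; rewrite size_filter.
have -> : map (@tgt G) (parrows p) = map (vert p) (iota 1 l).
  apply: (@eq_from_nth _ (pstart p)); rewrite !size_map ?size_iota // => i il.
  have a0 : arrow G by move: il; case: (parrows p).
  by rewrite (nth_map a0) // (nth_map 0%N) ?size_iota // nth_iota // add1n (vertS a0).
by rewrite count_map; apply: eq_count => j.
Qed.

Lemma dim_V_returns d : finitely_many_uniserials I p -> dim_V I p d ->
  (d < count_mem (pstart p) (pverts p))%N.
Proof.
move=> [n [M HM]] Hd; rewrite -size_returns ltnS.
(* One polynomial map for each isomorphism class; a class contributing no point gets the zero
   map. *)
have ex_Phi i : exists Phi : N.-tuple {mpoly K[m]}, forall k, class_points (M i) k ->
    exists c, forall j, k (enum_val j) = (tnth Phi j).@[c].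
  have [[k0 Vk0]|none] := pselect (exists k, @class_points K G I p (M i) k); last first.
    by exists [tuple 0 | j < N] => k Vk; case: none; exists k.
  have [U [x [Hx _ Hk]]] := class_points_common HI Vk0.
  have [Phi HPhi] := orbit_polynomials Hx.
  by exists Phi => k /Hk[y [py sy Ry]]; exact: HPhi py sy Ry.
have [Phi HPhi] := choice ex_Phi.
apply: (krull_dim_le (Phi := Phi)) Hd => k /(mast_variety_classes HM)[i /HPhi[c Hc]].
by exists i, c.
Qed.
End OrbitPolynomials.

Theorem theorem5p4 (K : fieldType) (K_infinite : infinite_set [set: K])
    (G : quiver) (I : ideal (path_algebra K G)) (I_admissible : admissible I)
    (HN : condition_N I)
    (p : qpath G) (p_mast : is_mast I p) (p_gt0 : (0 < plen p)%N)
    (p_finite : finitely_many_uniserials I p) :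
  (forall (alpha : arrow G) (u : qpath G),
     slack_halyard I p alpha u ->
     forall r : detour_index p,
       dx_arrow r = alpha -> dx_sub r = u -> slack_variable I r ->
       exists (w : qpath G) (eps : 'I_(plen u) -> qpath G),
         [/\ w \in right_subpaths p, pend w = pstart p, (0 < plen w)%N,
             forall i, pstart (eps i) = tgt (tnth (in_tuple (parrows u)) i) /\
                       pend (eps i) = tgt (tnth (in_tuple (parrows u)) i)
           & path_elt K (dx_target r) =
             path_elt K (arrow_path alpha) *
             (\prod_(i <- rev (enum 'I_(plen u)))
                (path_elt K (eps i) *
                 path_elt K (arrow_path (tnth (in_tuple (parrows u)) i)))) *
             path_elt K w])
  /\
  (forall d : nat, dim_V I p d ->
     (d.+1 <= count_mem (pstart p) (pverts p))%N).
Proof.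
split=> [alpha u _ r <- <- Hr|d]; last exact: dim_V_returns.
exact: (slack_factorisation I_admissible HN p_finite Hr).
Qed.
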